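(* Let $x_0\in\mathbb{T}$ and let $(\mathbb{T}^{\mathbb{N}},s)$ be the dynamical system with $s(x_1,x_2,x_3,\ldots)=(x_0x_1,\,x_1x_2,\,x_2x_3,\ldots)$ for $(x_k)_{k=1}^\infty\in\mathbb{T}^{\mathbb{N}}$. Then the Ellis group $E(\mathbb{T}^{\mathbb{N}},s)$ is topologically isomorphic to $(\mathcal{H},\star)$, and its topological centre is $\Lambda(E(\mathbb{T}^{\mathbb{N}},s))=\{s^n : n\in\mathbb{Z}\}$. Moreover, the members of $E(\mathbb{T}^{\mathbb{N}},s)$ are exactly the mappings of the form $$(x_1,x_2,\ldots)\mapsto(\phi_1(x_0)x_1,\ \phi_2(x_0)\phi_1(x_1)x_2,\ \ldots):\mathbb{T}^{\mathbb{N}}\to\mathbb{T}^{\mathbb{N}}$$ (that is, with $\phi_0=\mathrm{id}_{\mathbb{T}}$, the $k$-th coordinate of the image is $\prod_{j=0}^{k}\phi_{k-j}(x_j)$), where the sequence $(\phi_k)_{k=1}^\infty\in H(\mathbb{T})^{\mathbb{N}}$ satisfies $\phi_k(x^{k!})=\prod_{j=1}^k\phi_1^{(j)}(x^{s(k,j)})$ for all $x\in\mathbb{T}_Q$ and $k\in\mathbb{N}$.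
   Context: $\mathbb{N}=\{1,2,\ldots\}$, $\mathbb{Z}_+=\{0,1,2,\ldots\}$; $\mathbb{T}$ is the unit circle in $\mathbb{C}$, a group under multiplication; $\mathbb{T}_Q=\{e^{i2\pi q}:q\in\mathbb{Q}\}$. A dynamical system is a pair $(X,s)$ with $X$ a compact Hausdorff space and $s:X\to X$ a homeomorphism; its enveloping semigroup $E(X,s)$ is the closure of $\{s^n:n\in\mathbb{Z}\}$ in the product space $X^X$, with composition as operation. The systems considered here are distal, meaning that $E(X,s)$ is a group with identity $\mathrm{id}_X$ (then called the Ellis group). The topological centre of a right topological semigroup $S$ (all maps $u\mapsto uv$ continuous) is $\Lambda(S)=\{v\in S: u\mapsto vu\text{ is continuous}\}$. A topological isomorphism is a group isomorphism that is a homeomorphism. $H(\mathbb{T})$ is the set of all (not necessarily continuous) group homomorphisms $\mathbb{T}\to\mathbb{T}$, with the topology of pointwise convergence. For $n\in\mathbb{Z}$, $n^\times\in H(\mathbb{T})$ is $x\mapsto x^n$. $\phi^{(j)}$ denotes the $j$-fold composition of $\phi$ with itself. The integers $s(k,j)$ are the (signed) Stirling numbers of the first kind: $n(n-1)\cdots(n-k+1)=\sum_{j=0}^k s(k,j)n^j$. $\mathcal{H}$ is the set of all $(\phi_k)_{k=0}^\infty\in H(\mathbb{T})^{\mathbb{Z}_+}$ with $\phi_0=1^\times=\mathrm{id}_{\mathbb{T}}$ and $\phi_k(x^{k!})=\prod_{j=1}^k\phi_1^{(j)}(x^{s(k,j)})$ for all $x\in\mathbb{T}_Q$, $k\in\mathbb{N}$,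 with the subspace topology of the product. The group operation $\star$ on $\mathcal{H}$ is $(\phi\star\psi)_k=\prod_{j=0}^k\phi_{k-j}\circ\psi_j$ (pointwise product), $k\in\mathbb{Z}_+$. *)

(* Defs.v *)
From HB Require Import structures.
From mathcomp Require Import all_boot all_order all_algebra.
From mathcomp Require Import all_classical all_reals all_analysis.
From mathcomp Require Import complex.

Set Implicit Arguments.
Unset Strict Implicit.
Unset Printing Implicit Defensive.

Import Order.TTheory GRing.Theory Num.Theory.
Import numFieldNormedType.Exports.

Local Open Scope classical_set_scope.
Local Open Scope ring_scope.
Local Open Scope complex_scope.

Section DynamicalSystems.
Variables (X : ptopologicalType) (s : X -> X).

Definition dynamical_system : Prop :=
  [/\ compact [set: X], hausdorff_space X &
      [/\ bijective s, continuous s & continuous (pinv setT s)]].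

(* For bijective [s], [pinv setT s] is the inverse of [s]; the point of [X] is
   only its default value. *)
Definition ziter (n : int) : {ptws X -> X} :=
  match n with
  | Posz m => iter m s
  | Negz m => iter m.+1 (pinv setT s)
  end.

Definition enveloping_semigroup : set {ptws X -> X} := closure (range ziter).

End DynamicalSystems.

Definition ptws_comp (X : topologicalType) (f g : {ptws X -> X}) :
  {ptws X -> X} := f \o g.

Definition is_group (M : Type) (G : set M) (op : M -> M -> M) (e : M) : Prop :=
  [/\ forall u v, G u -> G v -> G (op u v),
      forall u v w, G u -> G v -> G w -> op u (op v w) = op (op u v) w,
      G e,
      forall u, G u -> op e u = u /\ op u e = u &
      forall u, G u -> exists v, [/\ G v, op v u = e & op u v = e]].

Definition distal (X : ptopologicalType) (s : X -> X) : Prop :=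
  is_group (enveloping_semigroup s) (@ptws_comp X) idfun.

Definition topological_centre (M : topologicalType) (S : set M)
    (op : M -> M -> M) : set M :=
  [set v | S v /\ {within S, continuous (op v)}].

Definition topologically_isomorphic (M N : topologicalType)
    (G : set M) (opG : M -> M -> M) (H : set N) (opH : N -> N -> N) : Prop :=
  exists (f : M -> N) (g : N -> M),
    [/\ {homo f : u / G u >-> H u} /\ {homo g : w / H w >-> G w},
        (forall u, G u -> g (f u) = u) /\ (forall w, H w -> f (g w) = w),
        forall u v, G u -> G v -> f (opG u v) = opH (f u) (f v),
        {within G, continuous f} &
        {within H, continuous g}].

Section Circle.
Variable R : realType.

Record circle : Type := Circle { cval : R[i]; _ : `|cval| == 1 }.

HB.instance Definition _ := [isSub for cval].
HB.instance Definition _ := [Choice of circle by <:].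

Fact circle_one_subproof : `|1 : R[i]| == 1.
Proof. by rewrite normr1. Qed.

Fact circle_mul_subproof (x y : circle) : `|val x * val y| == 1.
Proof. by rewrite normrM (eqP (valP x)) (eqP (valP y)) mulr1. Qed.

Fact circle_inv_subproof (x : circle) : `|(val x)^-1| == 1.
Proof. by rewrite normfV (eqP (valP x)) invr1. Qed.

Definition circle_one : circle := Circle circle_one_subproof.
Definition circle_mul (x y : circle) : circle := Circle (circle_mul_subproof x y).
Definition circle_inv (x : circle) : circle := Circle (circle_inv_subproof x).

Fact circle_mulA : associative circle_mul.
Proof. by move=> x y z; apply: val_inj; rewrite /= mulrA. Qed.

Fact circle_mul1 : left_id circle_one circle_mul.
Proof. by move=> x; apply: val_inj; rewrite /= mul1r. Qed.

Fact circle_1mul : right_id circle_one circle_mul.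
Proof. by move=> x; apply: val_inj; rewrite /= mulr1. Qed.

Fact circle_neq0 (x : circle) : val x != 0.
Proof. by rewrite -normr_eq0 (eqP (valP x)) oner_eq0. Qed.

Fact circle_mulV : left_inverse circle_one circle_inv circle_mul.
Proof. by move=> x; apply: val_inj; rewrite /= mulVf // circle_neq0. Qed.

Fact circle_Vmul : right_inverse circle_one circle_inv circle_mul.
Proof. by move=> x; apply: val_inj; rewrite /= mulfV // circle_neq0. Qed.

HB.instance Definition _ := isGroup.Build circle
  circle_mulA circle_mul1 circle_1mul circle_mulV circle_Vmul.

HB.instance Definition _ := isPointed.Build circle circle_one.

HB.instance Definition _ := Topological.copy circle
  (initial_topology (cval : circle -> R[i]^o)).

Definition circleQ : set circle :=
  [set z | exists q : rat,
     cval z = cos (2 * pi * ratr q) +i* sin (2 * pi * ratr q)].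

Definition circle_hom : set {ptws circle -> circle} :=
  [set f : circle -> circle | {morph f : x y / (x * y)%g}].

End Circle.

Definition expgz (G : groupType) (x : G) (n : int) : G :=
  match n with
  | Posz m => (x ^+ m)%g
  | Negz m => (x ^- m.+1)%g
  end.

(* Signed Stirling numbers of the first kind, read off from
   n(n-1)...(n-k+1) = sum_j s(k,j) n^j. *)
Definition stirling1 (k j : nat) : int :=
  (\prod_(i < k) ('X - (i%:R)%:P) : {poly int})`_j.

Section Hgroup.
Variable R : realType.
Notation T := (circle R).

Definition hom_seq : Type := {ptws nat -> {ptws T -> T}}.
HB.instance Definition _ := Topological.on hom_seq.

Definition calH : set hom_seq :=
  [set phi |
    [/\ phi 0%N = idfun,
        forall k, circle_hom (phi k) &
        forall k, (0 < k)%N -> forall x : T, circleQ x ->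
          phi k (x ^+ k`!)%g =
          (\prod_(1 <= j < k.+1) iter j (phi 1%N) (expgz x (stirling1 k j)))%g]].

Definition star (phi psi : hom_seq) : hom_seq :=
  fun k x => (\prod_(0 <= j < k.+1) phi (k - j)%N (psi j x))%g.

(* The space T^N, N = {1, 2, ...}: the coordinate x_k is [x k.-1]. With
   [extend], x_0 is put in front and the index is k itself. *)
Definition torus : Type := {ptws nat -> T}.
HB.instance Definition _ := Topological.on torus.
HB.instance Definition _ := isPointed.Build torus (fun=> point).

Definition extend (x0 : T) (x : torus) (k : nat) : T :=
  if k is i.+1 then x i else x0.

(* Coordinate k = i + 1 of the image is x_{k-1} x_k. *)
Definition shift_mul (x0 : T) (x : torus) : torus :=
  fun i => (extend x0 x i * extend x0 x i.+1)%g.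

(* Coordinate k = i + 1 of the image is the product of the phi_{k-j}(x_j),
   0 <= j <= k. *)
Definition hom_seq_map (x0 : T) (phi : hom_seq) : {ptws torus -> torus} :=
  fun x i => (\prod_(0 <= j < i.+2) phi (i.+1 - j)%N (extend x0 x j))%g.

End Hgroup.

(* Main.v *)
(* Write the circle additively. The iterate s^n acts through the sequence
   Bin n of the maps x |-> binz n k x, so the Ellis group is the image of the
   closure of {Bin n} in the space of sequences of homomorphisms, and the point
   is to prove that this closure is all of calH.
   For a single homomorphism f this is Kronecker's theorem: n x_i is close to
   f(x_i) for some n. Following Bohr, the average over n of the 2q-th power of
   |sum_i exp(n x_i - f(x_i))| does not depend on f, and it is so large that the
   modulus must come close to the number of terms.
   The later terms need no equidistribution of polynomial sequences. Suppose the
   first k + 1 terms can be prescribed. The (k + 2)nd terms of those elements of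
   the closure whose earlier terms are trivial form a closed subgroup, and the
   noncommutativity of star puts into it every al o bt - bt o al with al trivial
   on the torsion. By a divisibility argument such differences realise any
   homomorphism trivial on the torsion at any finite set of points, and the
   closed subgroup contains all of them. This is exactly the freedom left in
   calH, where the values on the torsion are determined by the first term.
   If the left translation by phi is continuous, each phi_k is continuous,
   because phi_k(psi_1(x)) is one of the terms of phi star psi and psi_1(x)
   runs over the circle when x is not a torsion point. Then phi_1 = n for an
   integer n, and phi = Bin n by density of the torsion. *)
Require Import Defs.
From HB Require Import structures.
From mathcomp Require Import all_boot all_order all_algebra.
From mathcomp Require Import all_classical all_reals all_analysis.
From mathcomp Require Import complex.
From mathcomp Require Import ring lra zify.

Set Implicit Arguments.
Unset Strict Implicit.
Unset Printing Implicit Defensive.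

Import Order.TTheory GRing.Theory Num.Theory.
Import numFieldNormedType.Exports.

Local Open Scope classical_set_scope.
Local Open Scope ring_scope.

(** * The circle as a topological abelian group *)

Section CircleGroup.
Variable R : realType.
Local Notation T := (circle R).

Fact circle_mulC : commutative (@circle_mul R).
Proof. by move=> x y; apply: val_inj; rewrite /= mulrC. Qed.

HB.instance Definition _ := GRing.isZmodule.Build T
  (@circle_mulA R) circle_mulC (@circle_mul1 R) (@circle_mulV R).

Lemma mulgE (x y : T) : (x * y)%g = x + y. Proof. by []. Qed.
Lemma expgE (x : T) n : (x ^+ n)%g = x *+ n.
Proof. by elim: n => // n IH; rewrite monoid.expgS mulrS IH. Qed.
Lemma expgzE (x : T) n : expgz x n = x *~ n.
Proof. by case: n => n; rewrite /expgz expgE. Qed.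

Lemma cvalD (x y : T) : cval (x + y) = cval x * cval y. Proof. by []. Qed.
Lemma cvalN (x : T) : cval (- x) = (cval x)^-1. Proof. by []. Qed.
Lemma cvalMn (x : T) n : cval (x *+ n) = cval x ^+ n.
Proof. by elim: n => // n IH; rewrite mulrS cvalD IH exprS. Qed.

Definition re (z : T) : R := complex.Re (cval z).
Definition im (z : T) : R := complex.Im (cval z).

Lemma re2_im2 z : re z ^+ 2 + im z ^+ 2 = 1.
Proof.
have := valP z; rewrite /= normc_def /re /im; case: (val z) => a b /=.
move=> /eqP/complexI e; rewrite -[LHS]sqr_sqrtr ?e ?expr1n //.
by rewrite addr_ge0 ?sqr_ge0.
Qed.

Lemma circle_ext (x y : T) : re x = re y -> im x = im y -> x = y.
Proof.
move=> e1 e2; apply: val_inj; move: e1 e2; rewrite /re /im /=.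
by case: (cval x) (cval y) => a b [c d] /= -> ->.
Qed.

Lemma reD (x y : T) : re (x + y) = re x * re y - im x * im y.
Proof. by rewrite /re /im cvalD; case: (cval x) (cval y) => a b [c d]. Qed.
Lemma imD (x y : T) : im (x + y) = re x * im y + im x * re y.
Proof. by rewrite /re /im cvalD; case: (cval x) (cval y) => a b [c d]. Qed.
Lemma re0 : re 0 = 1. Proof. by []. Qed.
Lemma im0 : im 0 = 0. Proof. by []. Qed.
Lemma reN x : re (- x) = re x.
Proof.
have := re2_im2 x; rewrite /re /im cvalN; case: (cval x) => a b /= ->.
by rewrite divr1.
Qed.
Lemma imN x : im (- x) = - im x.
Proof.
have := re2_im2 x; rewrite /re /im cvalN; case: (cval x) => a b /= ->.
by rewrite divr1.
Qed.

Lemma re_le1 x : re x <= 1.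
Proof. by have := re2_im2 x; nra. Qed.

Lemma re_eq1 x : re x = 1 -> x = 0.
Proof.
move=> e; apply: circle_ext; rewrite ?re0 ?im0 //.
have := re2_im2 x; rewrite e expr1n => h; apply/eqP; rewrite -sqrf_eq0.
by apply/eqP; move: h; lra.
Qed.

(** This does duty for the triangle inequality: [1 - re x] is half the squared distance from [x] to
    the identity, so doubling a distance multiplies it by 4. *)
Lemma reD_gt (x y : T) r : 1 - r < re x -> 1 - r < re y -> 1 - 4 * r < re (x + y).
Proof.
rewrite reD; have := re2_im2 x; have := re2_im2 y; have := re_le1 x; have := re_le1 y.
move: (re x) (im x) (re y) (im y) => a b c d.
move=> c1 a1 h2 h1 ra rc.
have : b * d <= (b ^+ 2 + d ^+ 2) / 2 by have := sqr_ge0 (b - d); nra.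
nra.
Qed.

Lemma dist_cval (x y : T) : `|cval x - cval y| ^+ 2 = (2 * (1 - re (x - y)))%:C%C.
Proof.
rewrite -add_Re2_Im2 reD reN imN; congr (_ %:C)%C.
have := re2_im2 x; have := re2_im2 y; rewrite /re /im.
by case: (cval x) (cval y) => a b [c d] /=; nra.
Qed.

(** By [dist_cval], the points within distance [d] of [x] are those with [re (y - x)] above
    [1 - d ^+ 2 / 2]. All limits on the circle thus become real inequalities. *)
Lemma nbhs_circleP (x : T) (U : set T) :
  nbhs x U <-> exists2 r : R, 0 < r & forall y, 1 - r < re (y - x) -> U y.
Proof.
split.
  case=> V [[W oW <-]] /= Wx VU.
  have /nbhs_ballP[e /= e0 eW] : nbhs (cval x : R[i]^o) W by exact: open_nbhs_nbhs.
  have [d d0 ed] : exists2 d : R, 0 < d & e = d%:C%C.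
    exists (complex.Re e); first by move: e0; rewrite ltcE /= => /andP[].
    by rewrite RRe_real // gtr0_real.
  exists (d ^+ 2 / 2); first by rewrite divr_gt0 ?exprn_gt0.
  move=> y hy; apply: VU; apply: eW; rewrite -ball_normE /= ed.
  rewrite -(@ltr_pXn2r _ 2) ?nnegrE ?normr_ge0 ?ler0c ?(ltW d0) //.
  rewrite dist_cval -rmorphXn ltcR -[re (x - y)]reN opprB; lra.
case=> r r0 rU.
have d0 : 0 < Num.sqrt (2 * r) by rewrite sqrtr_gt0; lra.
exists (@cval R @^-1` (ball (cval x : R[i]^o) (Num.sqrt (2 * r))%:C%C)); split => /=.
- by exists (ball (cval x : R[i]^o) (Num.sqrt (2 * r))%:C%C) => //; exact: ball_open.
- by apply: ballxx; rewrite ltcR.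
- move=> y; rewrite /= -ball_normE /= => h; apply: rU.
  move: h; rewrite -(@ltr_pXn2r _ 2) ?nnegrE ?normr_ge0 ?ler0c ?(ltW d0) //.
  rewrite dist_cval -rmorphXn ltcR sqr_sqrtr; last by lra.
  rewrite -[re (x - y)]reN opprB; lra.
Qed.

Lemma nbhs_re (x : T) (r : R) : 0 < r -> \forall y \near x, 1 - r < re (y - x).
Proof. by move=> r0; apply/nbhs_circleP; exists r. Qed.

Lemma circle_cvgP S (F : set_system S) (f : S -> T) (x : T) : Filter F ->
  (f @ F --> x) <-> forall r : R, 0 < r -> \forall s \near F, 1 - r < re (f s - x).
Proof.
move=> FF; split.
  by move=> h r r0; apply: (h [set y | 1 - r < re (y - x)]); exact: nbhs_re.
move=> h U /nbhs_circleP[r r0 rU]; apply: filterS (h r r0) => s /=; exact: rU.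
Qed.

Lemma circle_cvgD S (F : set_system S) (f g : S -> T) (x y : T) : Filter F ->
  f @ F --> x -> g @ F --> y -> (fun s => f s + g s) @ F --> x + y.
Proof.
move=> FF /circle_cvgP hf /circle_cvgP hg; apply/circle_cvgP => r r0.
have r4 : 0 < r / 4 by rewrite divr_gt0.
near=> s; have -> : f s + g s - (x + y) = (f s - x) + (g s - y) by rewrite opprD addrACA.
have -> : 1 - r = 1 - 4 * (r / 4) by field.
apply: reD_gt; [near: s; exact: hf | near: s; exact: hg].
Unshelve. all: by end_near. Qed.

Lemma circle_cvgN S (F : set_system S) (f : S -> T) (x : T) : Filter F ->
  f @ F --> x -> (fun s => - f s) @ F --> - x.
Proof.
move=> FF /circle_cvgP hf; apply/circle_cvgP => r /hf; apply: filterS => s.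
by rewrite -opprD reN.
Qed.

Lemma circle_cvg_sum S (F : set_system S) I (s : seq I) (P : pred I)
    (f : I -> S -> T) (x : I -> T) : Filter F ->
  (forall i, P i -> f i @ F --> x i) ->
  (fun t => \sum_(i <- s | P i) f i t) @ F --> \sum_(i <- s | P i) x i.
Proof.
move=> FF h; elim: s => [|i s IH].
  by under eq_fun do rewrite big_nil; rewrite big_nil; exact: cvg_cst.
under eq_fun do rewrite big_cons; rewrite big_cons.
by case: ifP => // Pi; apply: circle_cvgD => //; exact: h.
Qed.

Lemma circle_cvgMz S (F : set_system S) (f : S -> T) (x : T) n : Filter F ->
  f @ F --> x -> (fun s => f s *~ n) @ F --> x *~ n.
Proof.
move=> FF h.
have hn (m : nat) : (fun s => f s *+ m) @ F --> x *+ m.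
  elim: m => [|m IH]; first by under eq_fun do rewrite mulr0n; exact: cvg_cst.
  under eq_fun do rewrite mulrS; rewrite mulrS; exact: circle_cvgD.
case: n => n; first exact: hn.
by apply: circle_cvgN; exact: (hn n.+1).
Qed.

Lemma hausdorff_circle : hausdorff_space T.
Proof.
move=> x y h; apply/eqP; rewrite -subr_eq0; apply/eqP/re_eq1.
apply/eqP; rewrite eq_le re_le1 /=; apply/ler_addgt0Pr => r r0.
have r4 : 0 < r / 4 by rewrite divr_gt0.
have [z [/= zx zy]] := h _ _ (nbhs_re x r4) (nbhs_re y r4).
have := reD_gt (x := x - z) (y := z - y) (r := r / 4).
rewrite -[x - z]opprB reN addrA opprB addrNK => /(_ zx zy); lra.
Qed.

End CircleGroup.

Section CircleHom.
Variable R : realType.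
Local Notation T := (circle R).
Variable f : T -> T.
Hypothesis fD : circle_hom f.

Lemma homD x y : f (x + y) = f x + f y. Proof. exact: fD. Qed.
Lemma hom0 : f 0 = 0.
Proof. by apply: (addrI (f 0)); rewrite -homD !addr0. Qed.
Lemma homN x : f (- x) = - f x.
Proof. by apply: (addrI (f x)); rewrite -homD !subrr hom0. Qed.
Lemma homB x y : f (x - y) = f x - f y.
Proof. by rewrite homD homN. Qed.
Lemma homMn x n : f (x *+ n) = f x *+ n.
Proof. by elim: n => [|n IH]; rewrite ?hom0 // !mulrS homD IH. Qed.
Lemma homMz x n : f (x *~ n) = f x *~ n.
Proof.
by case: n => n; [exact: homMn | rewrite NegzE !mulrNz homN; congr (- _); exact: homMn].
Qed.
Lemma hom_sum I (s : seq I) (P : pred I) F :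
  f (\sum_(i <- s | P i) F i) = \sum_(i <- s | P i) f (F i).
Proof. by apply: (big_morph f homD hom0). Qed.

End CircleHom.

(** * The exponential parametrisation of the circle *)

Section CircleExp.
Variable R : realType.
Local Notation T := (circle R).

Fact circ_subproof (t : R) :
  `|(cos (2 * pi * t) +i* sin (2 * pi * t))%C : R[i]| == 1.
Proof. by rewrite normc_def /= cos2Dsin2 sqrtr1. Qed.

Definition circ (t : R) : T := Circle (circ_subproof t).

Lemma re_circ t : re (circ t) = cos (2 * pi * t). Proof. by []. Qed.
Lemma im_circ t : im (circ t) = sin (2 * pi * t). Proof. by []. Qed.

Lemma circD s t : circ (s + t) = circ s + circ t.
Proof.
apply: circle_ext; rewrite ?(reD, imD) !(re_circ, im_circ) mulrDr ?cosD ?sinD //.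
by rewrite addrC [sin _ * _]mulrC [cos (2 * pi * t) * _]mulrC mulrC.
Qed.

Lemma circN t : circ (- t) = - circ t.
Proof.
by apply: circle_ext; rewrite ?(reN, imN) !(re_circ, im_circ) mulrN ?cosN ?sinN.
Qed.

Lemma circ0 : circ 0 = 0.
Proof. by apply: (addrI (circ 0)); rewrite -circD !addr0. Qed.

Lemma circB s t : circ (s - t) = circ s - circ t.
Proof. by rewrite circD circN. Qed.

Lemma circMn t n : circ (t *+ n) = circ t *+ n.
Proof. by elim: n => [|n IH]; rewrite ?circ0 // !mulrS circD IH. Qed.

Lemma circMz t n : circ (t *~ n) = circ t *~ n.
Proof.
by case: n => n; [exact: circMn|rewrite NegzE !mulrNz circN; congr (- _); exact: circMn].
Qed.

Lemma circ_int (n : int) : circ n%:~R = 0.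
Proof.
rewrite circMz (_ : circ 1 = 0) ?mul0rz //.
by apply: circle_ext; rewrite ?(re_circ, im_circ) mulr1 mulr_natl ?cos2pi ?sin2pi.
Qed.

Lemma circ_eq0 t : circ t = 0 -> exists n : int, t = n%:~R.
Proof.
(* The integer nearest to [t]: the difference [u] then has modulus at most 1/2, so [2 * pi * |u|]
   stays in the interval on which [cos] is injective. *)
move=> t0; set n := Num.floor (t + 1 / 2); exists n.
have := Num.Theory.floor_itv (t + 1 / 2); rewrite -/n => /andP[n1 n2].
have : circ (t - n%:~R) = 0 by rewrite circB t0 circ_int subr0.
rewrite intrD in n2; set u := t - n%:~R.
have hu : `|u| <= 1 / 2 by rewrite ler_norml; apply/andP; split; rewrite /u; lra.
move/(congr1 (@re R)); rewrite re_circ re0 -cos_norm => cu.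
have p0 := pi_gt0 R.
have /cos_inj : cos `|2 * pi * u| = cos 0 by rewrite cu cos0.
rewrite !in_itv /= lexx pi_ge0 normr_ge0 /=; move=> /(_ _ isT) H.
have {}H : `|2 * pi * u| = 0.
  apply: H.
  rewrite normrM gtr0_norm ?mulr_gt0 //.
  by nra.
move/eqP: H; rewrite normr_eq0 !mulf_eq0 pnatr_eq0 /= gt_eqF //= subr_eq0.
by move/eqP.
Qed.

Lemma circ_surj (x : T) : exists2 t, `|t| <= 1 / 2 & circ t = x.
Proof.
have p0 := pi_gt0 R.
have hre : -1 <= re x <= 1 by have := re2_im2 x; nra.
have := acos_ge0 hre; have := acos_lepi hre; move: (acosK (x := re x)).
rewrite in_itv /= => /(_ hre) ea.
have := sin_acos hre; set a := acos _ in ea * => es a1 a0.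
have E : 2 * pi * (a / (2 * pi)) = a by rewrite mulrC divfK // gt_eqF ?mulr_gt0.
have ha : `|a / (2 * pi)| <= 1 / 2.
  by rewrite ler_norml; move: E; set t := a / _ => E; apply/andP; split; nra.
have hx : 1 - re x ^+ 2 = im x ^+ 2 by have := re2_im2 x; lra.
rewrite hx sqrtr_sqr in es.
have [i0|i0] := leP 0 (im x).
  exists (a / (2 * pi)) => //; apply: circle_ext; rewrite ?(re_circ, im_circ) E //.
  by rewrite es ger0_norm.
exists (- (a / (2 * pi))); rewrite ?normrN //.
apply: circle_ext; rewrite circN ?(reN, imN) ?(re_circ, im_circ) E //.
by rewrite es ltr0_norm ?opprK.
Qed.

Lemma circ_continuous : continuous circ.
Proof.
move=> t; apply/circle_cvgP => r r0.
have : (fun s => cos (2 * pi * (s - t))) @ t --> cos (2 * pi * (t - t)).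
  apply: (@continuous_comp _ _ _ (fun s => 2 * pi * (s - t)) cos); last exact: continuous_cos.
  by apply: cvgMr; apply: cvgB; [exact: cvg_id | exact: cvg_cst].
rewrite subrr mulr0 cos0 => /cvgrPdist_lt /(_ _ r0); apply: filterS => s.
by rewrite -circB re_circ ltr_norml => /andP[_]; lra.
Qed.

Lemma compact_circle : compact [set: T].
Proof.
have -> : [set: T] = circ @` `[- (1 / 2), 1 / 2]%classic.
  apply/seteqP; split => // x _; have [t t1 tx] := circ_surj x.
  by exists t => //=; rewrite in_itv /= -ler_norml.
apply: continuous_compact; last exact: segment_compact.
exact/continuous_subspaceT/circ_continuous.
Qed.

Lemma circle_div (x : T) n : (0 < n)%N -> exists y, y *+ n = x.
Proof.
move=> n0; have [t _ <-] := circ_surj x; exists (circ (t / n%:R)).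
by rewrite -circMn -[(t / _) *+ n]mulr_natr divfK // pnatr_eq0 -lt0n.
Qed.

Lemma torsion_circ (x : T) n : (0 < n)%N -> x *+ n = 0 ->
  exists k : int, x = circ (n%:R^-1) *~ k.
Proof.
move=> n0; have [t _ <-] := circ_surj x; rewrite -circMn => /circ_eq0[k hk].
exists k; rewrite -circMz; congr circ.
have n1 : n%:R != 0 :> R by rewrite pnatr_eq0 -lt0n.
by apply: (mulIf n1); rewrite mulr_natr hk -[_^-1 *~ k]mulrzl divfK.
Qed.

Lemma circ_invn n : (0 < n)%N -> circ (n%:R^-1) *+ n = 0.
Proof.
by move=> n0; rewrite -circMn -[n%:R^-1 *+ n]mulr_natr mulVf ?pnatr_eq0 -?lt0n // (circ_int 1).
Qed.

Lemma circleQP (x : T) : circleQ x <-> exists2 n, (0 < n)%N & x *+ n = 0.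
Proof.
split=> [[q hq]|[n n0 xn]].
  have -> : x = circ (ratr q) by apply: val_inj.
  exists `|denq q|%N; first by rewrite absz_gt0 denq_neq0.
  rewrite -circMn -[ratr q *+ _]mulr_natr natr_absz gtr0_norm ?denq_gt0 //.
  rewrite -(ratr_int R (denq q)) -rmorphM /= -numqE ratr_int.
  exact: circ_int.
have [k ->] := torsion_circ n0 xn; exists (k%:~R / n%:R).
rewrite -circMz /= fmorph_div /= ratr_int ratr_nat.
by rewrite -[_^-1 *~ k]mulrzl.
Qed.

(** The binary truncations [u j] of a lift [t] converge to [t], and dropping finitely many of them
    does not change the limit; hence the bound [J]. *)
Lemma dyadic_dense (f g : T -> T) (J : nat) : continuous f -> continuous g ->
  (forall j (k : int), (J <= j)%N ->
     f (circ (2 ^- j) *~ k) = g (circ (2 ^- j) *~ k)) ->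
  f = g.
Proof.
move=> cf cg fg; apply/funext => x; have [t _ <-] := circ_surj x.
pose u (j : nat) : R := 2 ^- j *~ Num.floor (t * 2 ^+ j).
have p2 j : 0 < 2 ^+ j :> R by rewrite exprn_gt0.
have ut : u @ \oo --> t.
  apply/cvgrPdist_lt => r r0.
  have := @cvg_geometric R 1 (2^-1) _; rewrite gtr0_norm ?invr_gt0 //.
  rewrite invf_lt1 // ltr1n => /(_ isT) /cvgrPdist_lt/(_ _ r0); apply: filterS => j.
  rewrite sub0r normrN /= mul1r exprVn gtr0_norm ?invr_gt0 //; apply: le_lt_trans.
  have := Num.Theory.floor_itv (t * 2 ^+ j).
  rewrite /u -[(2 ^- j) *~ _]mulrzl intrD; set m := (Num.floor _)%:~R => /andP[m1 m2].
  have -> : t - m / 2 ^+ j = (t * 2 ^+ j - m) / 2 ^+ j by field; rewrite gt_eqF.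
  rewrite ger0_norm ?divr_ge0 ?subr_ge0 ?(ltW (p2 j)) //.
  by rewrite -[leRHS]mul1r ler_pM2r ?invr_gt0 //; lra.
have cu : (circ \o u) @ \oo --> circ t.
  by apply: cvg_comp ut _; exact: circ_continuous.
have fu : (f \o (circ \o u)) @ \oo --> f (circ t) by apply: cvg_comp cu _; exact: cf.
have gu : (g \o (circ \o u)) @ \oo --> g (circ t) by apply: cvg_comp cu _; exact: cg.
apply: (@cvg_unique _ (@hausdorff_circle R) (g \o (circ \o u) @ \oo)) => //.
apply: cvg_trans fu; apply: near_eq_cvg; near=> j.
rewrite /= /u circMz fg //; near: j; exact: nbhs_infty_ge.
Unshelve. all: by end_near. Qed.

Lemma dyadic_torsion j (k : int) : (circ (2 ^- j) *~ k) *+ (2 ^ j) = 0.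
Proof.
rewrite pmulrn -mulrzA mulrC mulrzA -pmulrn -natrX circ_invn ?expn_gt0 //.
by rewrite mul0rz.
Qed.

Lemma circ_small_re (s : R) : `|s| < 1 / 4 -> 0 < re (circ s).
Proof.
have p0 := pi_gt0 R.
rewrite re_circ => /ltr_normlP[h1 h2]; apply: cos_gt0_pihalf.
by apply/andP; split; nra.
Qed.

Lemma circ_small (s : R) : `|s| <= 1 / 2 -> 0 < re (circ s) -> `|s| < 1 / 4.
Proof.
have p0 := pi_gt0 R; move=> h1 h2; rewrite ltNge; apply/negP => h3.
move: h2; rewrite re_circ -cos_norm normrM gtr0_norm ?mulr_gt0 // ltNge => /negP; apply.
rewrite -(cos_pihalf R) -subr_ge0; set c := 2 * pi * `|s|.
have c1 : pi / 2 <= c by rewrite /c; nra.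
have c2 : c <= pi by rewrite /c; nra.
have [->|ne] := eqVneq c (pi / 2); first by rewrite subrr.
rewrite subr_ge0 ltW // ltr_cos ?in_itv /=; last 2 first.
- by apply/andP; split; lra.
- by apply/andP; split; lra.
by rewrite lt_neqAle eq_sym ne c1.
Qed.

(** Such a [d] is the identity or the half turn, and the half turn reverses the sign of the real
    part. *)
Lemma double0_re (d : T) : d *+ 2 = 0 -> d = 0 \/ forall a, re (a + d) = - re a.
Proof.
rewrite mulr2n => d0; have := re2_im2 d.
have := congr1 (@re R) d0; have := congr1 (@im R) d0; rewrite reD imD re0 im0.
move=> h1 h2 h3.
have i0 : im d = 0 by apply/eqP; rewrite -sqrf_eq0; apply/eqP; lra.
have : (re d - 1) * (re d + 1) = 0 by rewrite i0 in h3; lra.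
move/eqP; rewrite mulf_eq0 => /orP[/eqP h|/eqP h].
  by left; apply: re_eq1; lra.
by right=> a; rewrite reD i0 (_ : re d = -1); lra.
Qed.

(* Near the identity the values of [f] have positive real part, which selects
   at each step one of the two square roots: from [circ (2 ^- J)] on, [f] is
   multiplication by a fixed integer on all dyadic points. *)
Lemma continuous_circle_hom (f : T -> T) : {morph f : x y / x + y} ->
  continuous f -> exists n : int, forall x, f x = x *~ n.
Proof.
move=> fD cf.
have f0 := hom0 fD; have fMn := homMn fD; have fMz := homMz fD.
have [J hJ] : exists J, forall j, (J <= j)%N -> 0 < re (f (circ (2 ^- j))).
  have cfc : (f \o circ) @ (0 : R) --> (0 : T).
    rewrite -[X in _ --> X]f0 -circ0.
    by apply: continuous_comp; [exact: circ_continuous | exact: cf].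
  have := @cvg_geometric R 1 (2^-1) _; rewrite gtr0_norm ?invr_gt0 //.
  rewrite invf_lt1 // ltr1n => /(_ isT) hg.
  have /circle_cvgP/(_ 1 ltr01)[J _ hJ] := cvg_comp _ _ hg cfc.
  exists J => j /hJ /=; rewrite subrr subr0.
  by rewrite mul1r exprVn.
have [th th1 eth] := circ_surj (f (circ (2 ^- J))).
have th2 : `|th| < 1 / 4 by apply: circ_small => //; rewrite eth hJ.
(* The image of [circ (2 ^- J)] is again killed by [2 ^ J], so its lift [th] is a multiple of
   [2 ^- J]; the multiplier is the degree of [f]. *)
have [n hn] : exists n : int, th *+ 2 ^ J = n%:~R.
  apply: circ_eq0; rewrite circMn eth -fMn.
  by have := dyadic_torsion J 1; rewrite mulr1z => ->.
have key i : f (circ (2 ^- (J + i))) = circ (th * 2 ^- i).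
  elim: i => [|i IH]; first by rewrite addn0 expr0 invr1 mulr1 eth.
  have half (k : nat) : (2 ^- k : R) = 2 ^- k.+1 *+ 2.
    by rewrite -mulr_natr exprSr; field; rewrite expf_neq0.
  set w := f _; have : (w - circ (th * 2 ^- i.+1)) *+ 2 = 0.
    rewrite mulrnBl -fMn -!circMn -mulrnAr addnS -!half IH; exact: subrr.
  case/double0_re => [/eqP|h]; first by rewrite subr_eq0 => /eqP.
  have := h (circ (th * 2 ^- i.+1)); rewrite addrC subrK => e.
  have := hJ (J + i.+1)%N (leq_addr _ _); rewrite -/w e oppr_gt0 ltNge ltW //.
  apply: circ_small_re; rewrite normrM; apply: le_lt_trans th2.
  rewrite ler_piMr // gtr0_norm ?invr_gt0 ?exprn_gt0 //.
  by rewrite invf_le1 ?exprn_gt0 // exprn_ege1 // ler1n.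
exists n; suff -> : f = (fun x => x *~ n) by [].
apply: (@dyadic_dense _ _ J) => //.
  by move=> x; apply: (@circle_cvgMz R T (nbhs x) id x n); exact: cvg_id.
move=> j k Jj; rewrite fMz -!mulrzA mulrC mulrzA; congr (_ *~ k).
rewrite -(subnKC Jj) key -circMz; congr circ.
rewrite -[_ *~ n]mulrzl -hn -[th *+ _]mulr_natr natrX exprD; field.
by rewrite !expf_neq0.
Qed.

End CircleExp.

(** * Generalised binomial coefficients *)

(* Generalised binomial coefficient [n (n - 1) ... (n - k + 1) / k!]; for
   negative [n = - m.+1] it is [(-1) ^ k * 'C(m + k, k)]. *)
Definition binz (n : int) (k : nat) : int :=
  match n with
  | Posz m => 'C(m, k)%:Z
  | Negz m => (-1) ^+ k * 'C(m + k, k)%:Z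
  end.

Lemma binz0 n : binz n 0 = 1.
Proof. by case: n => n; rewrite /= ?addn0 ?bin0 ?mulr1. Qed.

Lemma bin0z k : (0 < k)%N -> binz 0 k = 0.
Proof. by case: k. Qed.

Lemma binzS n k : binz (n + 1) k.+1 = binz n k.+1 + binz n k.
Proof.
case: n => [m|[|m]].
- by rewrite -PoszD addn1 /= binS PoszD.
- by rewrite (_ : Negz 0 + 1 = 0) // bin0z // /binz !add0n !binn exprS; ring.
- have -> : Negz m.+1 + 1 = Negz m by rewrite !NegzE; lia.
  rewrite /= !addnS !addSn [X in _ = _ * X%:Z + _]binS PoszD exprS; ring.
Qed.

Lemma binz1 n : binz n 1 = n.
Proof.
by case: n => n; rewrite /binz ?bin1 // expr1 NegzE mulN1r addn1.
Qed.

Lemma mul_binz n k : (k.+1)%:Z * binz n k.+1 = (n - k%:Z) * binz n k.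
Proof.
case: n => m /=.
  have [mk|km] := ltnP m k; first by rewrite !bin_small ?mulr0 // ltnW.
  by rewrite -PoszM mul_bin_left PoszM subzn.
have := mul_bin_diag (m + k).+1 k; rewrite /= addnS => e.
have -> : (k.+1)%:Z * ((-1) ^+ k.+1 * 'C((m + k).+1, k.+1)%:Z) =
  (-1) ^+ k.+1 * (k.+1 * 'C((m + k).+1, k.+1))%N%:Z by rewrite PoszM; ring.
by rewrite -e PoszM NegzE exprS -[in LHS]addnS PoszD; ring.
Qed.

Arguments binz : simpl never.

Lemma fact_binz n k :
  (k`!)%:Z * binz n k = \prod_(i < k) (n - i%:Z).
Proof.
elim: k => [|k IH]; first by rewrite big_ord0 binz0.
rewrite big_ord_recr /= -IH factS PoszM.
transitivity ((k`!)%:Z * ((k.+1)%:Z * binz n k.+1)); first by ring.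
by rewrite mul_binz; ring.
Qed.

Lemma stirling1E n k :
  \sum_(1 <= j < k.+2) stirling1 k.+1 j * n ^+ j = (k.+1`!)%:Z * binz n k.+1.
Proof.
set p : {poly int} := \prod_(i < k.+1) ('X - (i%:R)%:P).
have sp : size p = k.+2 by rewrite size_prod_XsubC /index_enum -enumT size_enum_ord.
have : p.[n] = (k.+1`!)%:Z * binz n k.+1.
  rewrite fact_binz horner_prod; apply: eq_bigr => i _.
  by rewrite hornerXsubC natz.
rewrite horner_coef sp big_ord_recl /= => <-.
(* The factor for [i = 0] is ['X], so the constant coefficient vanishes and the sum may start at
   1. *)
rewrite expr0 mulr1 -horner_coef0 horner_prod big_ord_recl hornerXsubC subrr mul0r add0r.
by rewrite big_add1 big_mkord.
Qed.

(** Both sides obey Pascal's rule in [m] and agree at [m = 0] and in degree 0. Going down to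
    negative [m], the rule is solved for its term of degree [k.+1], whence the inner induction on
    [k]. *)
Lemma Vandermonde_binz m n k :
  \sum_(j < k.+1) binz m (k - j) * binz n j = binz (m + n) k.
Proof.
pose b m k := \sum_(j < k.+1) binz m (k - j) * binz n j.
have bS m' k' : b (m' + 1) k'.+1 = b m' k'.+1 + b m' k'.
  rewrite /b [in LHS]big_ord_recr [X in _ = X + _]big_ord_recr /= subnn !binz0 addrAC.
  rewrite -big_split; congr (_ + _); apply: eq_bigr => i _ /=.
  by rewrite subSn ?binzS ?mulrDl // -ltnS.
have b0 m' : b m' 0%N = 1 by rewrite /b big_ord1 !binz0.
rewrite -/(b m k); elim/int_rect: m k => [|m IH|m IH] k.
- rewrite /b add0r big_ord_recr /= subnn binz0 mul1r big1 ?add0r // => i _.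
  by rewrite bin0z ?mul0r // subn_gt0.
- case: k => [|k]; first by rewrite b0 binz0.
  by rewrite -addn1 PoszD bS !IH -binzS; congr binz; ring.
- elim: k => [|k IHk]; first by rewrite b0 binz0.
  have e : - m%:Z = - (m.+1)%:Z + 1 by lia.
  by have := IH k.+1; rewrite e bS IHk addrAC binzS => /addIr.
Qed.

(** The falling factorial is a polynomial in [n] with integer coefficients, so it is periodic modulo
    [m * k]![; dividing by]k[!] leaves a multiple of [m]. *)
Lemma binz_period m k a t : (0 < m)%N -> 
  exists c : int, binz (a + t * (m * k`!)%N%:Z) k = binz a k + c * m%:Z.
Proof.
move=> m0; have k0 : (k`!)%:Z != 0 by rewrite eqz_nat -lt0n fact_gt0.
suff [c hc] : exists c : int, \prod_(i < k) (a + t * (m * k`!)%N%:Z - i%:Z) =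
    \prod_(i < k) (a - i%:Z) + c * (m * k`!)%N%:Z.
  exists c; apply: (mulfI k0); rewrite mulrDr !fact_binz hc PoszM; congr (_ + _); ring.
move: (m * _)%N%:Z => M; elim: k {k0} => [|k [c IH]].
  by exists 0; rewrite !big_ord0 mul0r addr0.
rewrite !big_ord_recr /= IH.
by exists (\prod_(i < k) (a - i%:Z) * t + c * (a + t * M - k%:Z)); ring.
Qed.

(** * The convolution product *)

Section Convolution.
Variable R : realType.
Local Notation T := (circle R).
Implicit Types (phi psi chi nu : hom_seq R) (y z : nat -> T).

(** One convolution serves both purposes: [star] applies it to the points [psi j x], and
    [hom_seq_map] to the sequence [extend x0 x]. *)
Definition conv phi y (k : nat) : T := \sum_(j < k.+1) phi (k - j)%N (y j).

Lemma starE phi psi k x : star phi psi k x = conv phi (psi^~ x) k.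
Proof. by rewrite /conv -(big_mkord xpredT (fun j => phi (k - j)%N (psi j x))). Qed.

Lemma hom_seq_mapE (x0 : T) phi x i :
  hom_seq_map x0 phi x i = conv phi (extend x0 x) i.+1.
Proof.
by rewrite /conv -(big_mkord xpredT (fun j => phi (i.+1 - j)%N (extend x0 x j))).
Qed.

Lemma eq_conv phi psi y z k : (forall i, (i <= k)%N -> phi i =1 psi i) ->
  (forall i, (i <= k)%N -> y i = z i) -> conv phi y k = conv psi z k.
Proof.
move=> pp yz; apply: eq_bigr => i _; rewrite pp ?leq_subr // yz //.
by rewrite -ltnS.
Qed.

Lemma conv_recl phi y k : conv phi y k.+1 = phi k.+1 (y 0%N) + conv phi (y \o succn) k.
Proof. by rewrite /conv big_ord_recl subn0. Qed.

Lemma conv_recr phi y k : conv phi y k.+1 = conv (phi \o succn) y k + phi 0%N (y k.+1).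
Proof.
rewrite /conv big_ord_recr /= subnn; congr (_ + _); apply: eq_bigr => i _ /=.
by rewrite subSn // -ltnS.
Qed.

Lemma conv_lowl phi y k : (forall i x, (i < k)%N -> phi i x = 0) ->
  conv phi y k = phi k (y 0%N).
Proof.
case: k => [|k] h; first by rewrite /conv big_ord1.
rewrite conv_recl /conv big1 ?addr0 // => i _.
by apply: h; rewrite ltnS leq_subr.
Qed.

Definition hom_group phi := phi 0%N = idfun /\ forall k, circle_hom (phi k).

Lemma conv_lowr phi y k : hom_group phi -> (forall i, (i < k)%N -> y i = 0) ->
  conv phi y k = y k.
Proof.
case=> phi0 hphi; case: k => [|k] h; first by rewrite /conv big_ord1 phi0.
rewrite conv_recr phi0 /conv big1 ?add0r // => i _ /=.
by rewrite h // (hom0 (hphi _)).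
Qed.

Lemma conv_first phi y k : hom_group phi ->
  (forall i x, (0 < i < k.+1)%N -> phi i x = 0) ->
  conv phi y k.+1 = phi k.+1 (y 0%N) + y k.+1.
Proof.
by move=> [phi0 _] h; rewrite conv_recr phi0 conv_lowl // => i x ik; apply: h.
Qed.

(** If [phi] starts in degree [k.+1], only its two lowest terms meet [y] in degree [k.+2]. Set
    against [conv_second_r], where [y] is the factor that starts late, this exhibits the commutator
    of two sequences. *)
Lemma conv_second phi y k : hom_group phi ->
  (forall i x, (0 < i < k.+1)%N -> phi i x = 0) ->
  conv phi y k.+2 = phi k.+2 (y 0%N) + phi k.+1 (y 1%N) + y k.+2.
Proof.
move=> [phi0 _] h; rewrite conv_recr phi0 conv_recl [conv _ (_ \o _) _]conv_lowl //.
by move=> i x ik; apply: h.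
Qed.

Lemma conv_second_r phi y k : hom_group phi ->
  (forall i, (0 < i < k.+1)%N -> y i = 0) ->
  conv phi y k.+2 = phi k.+2 (y 0%N) + (phi 1%N (y k.+1) + y k.+2).
Proof.
move=> [phi0 hphi] h; rewrite conv_recl conv_recr phi0; congr (_ + (_ + _)).
case: k h => [|k] h; first by rewrite /conv big_ord1.
rewrite conv_recr /= /conv big1 ?add0r // => i _ /=.
by rewrite h ?(hom0 (hphi _)) //= ltnS.
Qed.

Lemma conv_comp phi psi y k : (forall i, circle_hom (phi i)) ->
  conv phi (conv psi y) k = conv (star phi psi) y k.
Proof.
move=> hphi; rewrite /conv.
pose F i j := phi (k - j)%N (psi (j - i)%N (y i)).
(* The double sum over [i <= j <= k] is taken in the other order, with [l = j - i] as the new inner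
   index. *)
transitivity (\sum_(0 <= j < k.+1) \sum_(0 <= i < k.+1 | (i <= j)%N) F i j).
  rewrite big_mkord; apply: eq_bigr => j _; rewrite (hom_sum (hphi _)).
  rewrite -(big_mkord xpredT (fun i => F i j)) (big_nat_widen _ _ k.+1) //.
rewrite (exchange_big_dep_nat xpredT) //= big_mkord; apply: eq_bigr => i _.
rewrite starE /conv -(big_mkord xpredT (fun l => phi (k - i - l)%N (psi l (y i)))).
have ik : (i <= k)%N by rewrite -ltnS.
transitivity (\sum_(i <= j < k.+1) F i j).
  rewrite [in RHS](big_nat_widenl _ 0) //.
rewrite -{1}[nat_of_ord i]add0n big_addn subSn //; apply: eq_bigr => l _.
by rewrite /F addnK subnDA -subnAC.
Qed.

Definition star_one : hom_seq R := fun k => if k is 0%N then idfun else fun=> 0.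

Lemma hom_group_one : hom_group star_one.
Proof. by split => // -[|k] x y //=; rewrite !mulgE addr0. Qed.

Lemma hom_group_star phi psi : hom_group phi -> hom_group psi ->
  hom_group (star phi psi).
Proof.
move=> [phi0 hphi] [psi0 hpsi]; split.
  by apply/funext => x; rewrite starE /conv big_ord1 phi0 psi0.
move=> k x y; rewrite !starE !mulgE /conv -big_split; apply: eq_bigr => i _ /=.
by rewrite (homD (hpsi _)) (homD (hphi _)).
Qed.

Lemma hom_seq_ext phi psi : (forall k x, phi k x = psi k x) -> phi = psi.
Proof. by move=> h; apply/funext => k; apply/funext => x; exact: h. Qed.

Lemma starA phi psi chi : (forall i, circle_hom (phi i)) ->
  star phi (star psi chi) = star (star phi psi) chi.
Proof.
move=> hphi; apply: hom_seq_ext => k x; rewrite !starE -conv_comp //.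
by apply: eq_conv => // i _; rewrite starE.
Qed.

Lemma star1s phi : star star_one phi = phi.
Proof.
apply: hom_seq_ext => -[|k] x; rewrite starE; first by rewrite /conv big_ord1.
by rewrite conv_first ?add0r //; [exact: hom_group_one | case].
Qed.

Lemma stars1 phi : (forall i, circle_hom (phi i)) -> star phi star_one = phi.
Proof.
move=> hphi; apply: hom_seq_ext => -[|k] x; rewrite starE; first by rewrite /conv big_ord1.
rewrite conv_recl /conv big1 ?addr0 // => i _.
by rewrite (hom0 (hphi _)).
Qed.

(* [star_inv_iter n] is the inverse series computed with recursion depth [n]:
   its terms of degree below [n] are final. *)
Fixpoint star_inv_iter phi (n : nat) : hom_seq R :=
  if n is m.+1 then
    fun k => if k is k'.+1 then
      fun x => - conv (star_inv_iter phi m) (fun i => phi i.+1 x) k' else idfun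
  else star_one.

Definition star_inv phi : hom_seq R := fun k => star_inv_iter phi k.+1 k.

Lemma star_inv_iterS phi n k x : star_inv_iter phi n.+1 k.+1 x =
  - conv (star_inv_iter phi n) (fun i => phi i.+1 x) k.
Proof. by []. Qed.

Lemma star_inv_iterE phi n k : (k < n)%N -> star_inv_iter phi n k = star_inv phi k.
Proof.
elim/ltn_ind: n k => -[//|n] IH [//|k] kn; apply/funext => x.
rewrite /star_inv !star_inv_iterS; congr (- _); apply: eq_conv => // i ik.
by rewrite (IH n) ?(leq_ltn_trans ik) // (IH k.+1).
Qed.

Lemma star_invS phi k x :
  star_inv phi k.+1 x = - conv (star_inv phi) (fun i => phi i.+1 x) k.
Proof.
rewrite {1}/star_inv star_inv_iterS; congr (- _); apply: eq_conv => // i ik.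
by rewrite star_inv_iterE.
Qed.

Lemma hom_group_inv phi : hom_group phi -> hom_group (star_inv phi).
Proof.
move=> [phi0 hphi]; split => // k; elim/ltn_ind: k => -[|k] IH x y //.
rewrite !mulgE !star_invS -opprD; congr (- _).
rewrite /conv -big_split; apply: eq_bigr => i _.
by rewrite (homD (hphi _)) (homD (IH _ _)) // ltnS leq_subr.
Qed.

Lemma star_invK phi : hom_group phi -> star (star_inv phi) phi = star_one.
Proof.
move=> [phi0 hphi]; apply: hom_seq_ext => -[|k] x; rewrite starE.
  by rewrite /conv big_ord1 phi0.
by rewrite conv_recl phi0 star_invS addNr.
Qed.

(** A left inverse that has a left inverse itself is two-sided. *)
Lemma star_Kinv phi : hom_group phi -> star phi (star_inv phi) = star_one.
Proof.
move=> gphi; have gi := hom_group_inv gphi; have gii := hom_group_inv gi.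
have {1}-> : phi = star_inv (star_inv phi); last exact: star_invK.
rewrite -[LHS]star1s -(star_invK gi) -starA; last exact: gii.2.
by rewrite star_invK // stars1 //; exact: gii.2.
Qed.

Definition Bin (n : int) : hom_seq R := fun k x => x *~ binz n k.

Lemma hom_group_Bin n : hom_group (Bin n).
Proof.
split; first by apply/funext => x; rewrite /Bin binz0 mulr1z.
by move=> k x y; rewrite /Bin !mulgE mulrzDl.
Qed.

Lemma Bin0 : Bin 0 = star_one.
Proof.
apply: hom_seq_ext => -[|k] x; rewrite /Bin ?binz0 ?mulr1z // bin0z.
Qed.

Lemma conv_mulz m (n : nat -> int) (x : T) k :
  conv (Bin m) (fun j => x *~ n j) k = x *~ \sum_(j < k.+1) binz m (k - j) * n j.
Proof.
rewrite /conv (big_morph _ (mulrzDr x) (mulr0z x)); apply: eq_bigr => j _.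
by rewrite /Bin -mulrzA mulrC.
Qed.

Lemma star_Bin m n : star (Bin m) (Bin n) = Bin (m + n).
Proof.
by apply: hom_seq_ext => k x; rewrite starE conv_mulz Vandermonde_binz.
Qed.

End Convolution.

(** * Homomorphisms into divisible groups *)

Section DivisibleExtension.
Variables G D : zmodType.
Hypothesis divD : forall (d : D) n, (0 < n)%N -> exists e, e *+ n = d.

(** The graph of a homomorphism from a subgroup of [G] to [D]; for a subgroup of the product,
    single-valuedness need only be asked at 0. *)
Definition zmod_graph (X : set (G * D)) :=
  [/\ X 0, forall p q, X p -> X q -> X (p - q) & forall d, X (0, d) -> d = 0].

Lemma zmod_graphD X p q : zmod_graph X -> X p -> X q -> X (p + q).
Proof.
case=> X0 XB _ Xp Xq; rewrite -[q]opprK; apply: (XB) => //.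
by rewrite -[- q]sub0r; apply: XB.
Qed.

Lemma zmod_graphMn X p n : zmod_graph X -> X p -> X (p *+ n).
Proof.
move=> gX Xp; elim: n => [|n IH]; first by case: gX.
by rewrite mulrS; apply: zmod_graphD.
Qed.

Lemma zmod_graphMz X p (n : int) : zmod_graph X -> X p -> X (p *~ n).
Proof.
move=> gX Xp; case: n => n; first exact: zmod_graphMn.
rewrite NegzE mulrNz -[- _]sub0r; case: (gX) => X0 XB _.
by apply: (XB) => //; exact: (@zmod_graphMn X p n.+1).
Qed.

Lemma zmod_graph_fun X x d e : zmod_graph X -> X (x, d) -> X (x, e) -> d = e.
Proof.
case=> X0 XB Xf Xd Xe; apply/eqP; rewrite -subr_eq0; apply/eqP/Xf.
by have := XB _ _ Xd Xe; rewrite /GRing.add /= /GRing.opp /= /add_pair /= subrr.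
Qed.

Lemma pairD (p q : G * D) : p + q = (p.1 + q.1, p.2 + q.2). Proof. by []. Qed.
Lemma pairB (p q : G * D) : p - q = (p.1 - q.1, p.2 - q.2). Proof. by []. Qed.
Lemma pairMn (p : G * D) n : p *+ n = (p.1 *+ n, p.2 *+ n).
Proof. by elim: n => // n IH; rewrite !mulrS IH pairD. Qed.
Lemma pairMz (p : G * D) (n : int) : p *~ n = (p.1 *~ n, p.2 *~ n).
Proof.
case: n => n; first exact: pairMn.
by rewrite !NegzE !mulrNz -[p *~ n.+1]/(p *+ n.+1) pairMn.
Qed.

(* The new value [e] must satisfy [n e = d] as soon as [n x] already has image
   [d]: it suffices to divide at the least such [n]. *)
Lemma zmod_graph_slope X x : zmod_graph X ->
  exists e, forall (n : int) d, X (x *~ n, d) -> d = e *~ n.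
Proof.
move=> gX; have [[n [n0 [d Xd]]]|nX] :=
  pselect (exists n, (0 < n)%N /\ exists d, X (x *+ n, d)); last first.
  exists 0 => n d Xn; rewrite mul0rz.
  have [n0|n0] := eqVneq n 0.
    by move: Xn; rewrite n0 mulr0z; case: gX => _ _; exact.
  case: nX; exists `|n|%N; split; first by rewrite absz_gt0.
  case: (intP n) Xn n0 => [|m|m] Xn // _; first by exists d.
  exists (- d); have := zmod_graphMz (-1) gX Xn.
  by rewrite pairMz /= !mulrN1z -mulrNz opprK.
have P : exists m, (0 < m)%N && `[< exists d, X (x *+ m, d) >].
  by exists n; rewrite n0; apply/asboolP; exists d.
case: (ex_minnP P) => m /andP[m0 /asboolP[c Xc]] mmin.
have [e ec] := divD c m0; exists e => k b Xk.
have hr : X (x *~ (k %% m)%Z, b - c *~ (k %/ m)%Z).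
  have := zmod_graphMz (k %/ m)%Z gX Xc; rewrite pairMz /= => Xq.
  case: (gX) => _ XB _; have := XB _ _ Xk Xq; rewrite pairB /=.
  by rewrite pmulrn -mulrzA -mulrzBr {1}(divz_eq k m) mulrC addrAC subrr add0r.
(* A nonzero remainder would be a smaller positive multiple of [x] in the domain. *)
have r0 : (k %% m)%Z = 0.
  have [r rE] : exists r : nat, (k %% m)%Z = r.
    by exists `|(k %% m)%Z|%N; rewrite gez0_abs // modz_ge0 // gt_eqF.
  have rm : (r < m)%N by rewrite -ltz_nat -rE ltz_pmod.
  rewrite rE in hr *; case: r {rE} rm hr => // r rm hr.
  suff : (m <= r.+1)%N by rewrite leqNgt rm.
  by apply: mmin => /=; apply/asboolP; eexists; exact: hr.
rewrite r0 mulr0z in hr; case: (gX) => _ _ /(_ _ hr)/eqP; rewrite subr_eq0 => /eqP ->.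
by rewrite -ec pmulrn -mulrzA [in RHS](divz_eq k m) r0 addr0 mulrC.
Qed.

(** Divisible groups are injective: Zorn's lemma yields a maximal graph, and [zmod_graph_slope]
    would enlarge it at any point missing from its domain. *)
Lemma divisible_extension (X0 : set (G * D)) : zmod_graph X0 ->
  exists2 h : G -> D, {morph h : x y / x + y} & forall x d, X0 (x, d) -> h x = d.
Proof.
move=> g0; pose P X := X = set0 \/ (X0 `<=` X /\ zmod_graph X).
have [F FP Ftot|A [PA Amax]] := @Zorn_bigcup _ P.
  have [[X FX [Xx]]|nF] := pselect (exists2 X, F X & X !=set0); last first.
    left; rewrite -subset0 => x [X FX Xx]; apply: nF.
    by exists X => //; exists x.
  move=> XXx; right.
  have FG Y : F Y -> Y !=set0 -> X0 `<=` Y /\ zmod_graph Y.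
    by move=> FY [y Yy]; case: (FP _ FY) => // Y0; rewrite Y0 in Yy.
  have [X0X gX] : X0 `<=` X /\ zmod_graph X by apply: FG => //; exists Xx.
  split; first by move=> y /X0X Xy; exists X.
  split.
  - by exists X => //; case: gX.
  - move=> p q [Y FY Yp] [Z FZ Zq]; case: (Ftot _ _ FY FZ) => s.
      exists Z => //; have [_ [_ ZB _]] := FG _ FZ (ex_intro _ _ Zq).
      by apply: ZB => //; exact: s.
    exists Y => //; have [_ [_ YB _]] := FG _ FY (ex_intro _ _ Yp).
    by apply: YB => //; exact: s.
  - move=> d [Y FY Yd]; have [_ [_ _ Yf]] := FG _ FY (ex_intro _ _ Yd).
    exact: Yf.
have {PA} [X0A gA] : X0 `<=` A /\ zmod_graph A.
  case: PA => // A0; case: (Amax X0); last by right; split.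
  rewrite A0 properEneq; split => //; apply/eqP => e.
  by case: g0; rewrite -e.
have dom x : exists d, A (x, d).
  have [e he] := zmod_graph_slope x gA.
  pose B : set (G * D) := [set p | exists n : int, A (p - (x, e) *~ n)].
  have gB : zmod_graph B.
    split.
    - by exists 0; rewrite mulr0z subr0; case: gA.
    - move=> p q [m Am] [n An]; exists (m - n); case: gA => _ AB _.
      by have := AB _ _ Am An; rewrite mulrzBr !opprD addrACA.
    - move=> d [n]; rewrite pairMz pairB /= sub0r -mulrNz => /he.
      by rewrite mulrNz => /eqP; rewrite subr_eq addNr => /eqP.
  have AB : A `<=` B by move=> p Ap; exists 0; rewrite mulr0z subr0.
  have Bx : B (x, e) by exists 1; rewrite mulr1z subrr; case: gA.
  exists e; apply: contrapT => nA; apply: (Amax B).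
    by split=> // /(_ _ Bx).
  by right; split => //; exact: subset_trans AB.
have [h hA] := choice dom.
exists h; first last.
  by move=> x d /X0A; exact: zmod_graph_fun (hA x).
move=> x y; apply: zmod_graph_fun (hA _) _ => //.
exact: (zmod_graphD gA (hA x) (hA y)).
Qed.

End DivisibleExtension.

(** * Pointwise convergence and the set calH *)

Section PointwiseTopology.
Variables (U : choiceType) (V : topologicalType).

Lemma ptws_cvgP (F : set_system {ptws U -> V}) (f : {ptws U -> V}) : Filter F ->
  (F --> f) <-> forall t, (fun g : {ptws U -> V} => g t) @ F --> f t.
Proof.
move=> FF; have img (t : U) : [set (h : U -> V) t | h in [set: U -> V]] = [set: V].
  by rewrite eqEsubset; split=> v // _; exists (cst v).
split.
  move=> /cvg_sup Ff t; have /(cvg_image _ _ (img t)) := Ff t.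
  apply: cvg_trans => W /=; rewrite ?nbhs_simpl /fmap /= => [[W' + <-]].
  by apply: filterS => g W'g /=; exists g.
move=> h; apply/cvg_sup => t; apply/(cvg_image _ _ (img t)) => W /= Wt.
exists (@^~ t @^-1` W); first exact: h.
by rewrite eqEsubset; split => [j [? + <-//]|j Wj]; exists (fun _ => j).
Qed.

Lemma cvg_ptws S (F : set_system S) (h : S -> {ptws U -> V}) (f : {ptws U -> V}) : Filter F ->
  (forall t, (fun s => h s t) @ F --> f t) -> h @ F --> f.
Proof. by move=> FF hf; apply/ptws_cvgP => t; exact: hf. Qed.

Lemma ptws_eval_continuous t : continuous (fun g : {ptws U -> V} => g t).
Proof. by move=> g; have /ptws_cvgP := @cvg_id _ (nbhs g); apply. Qed.

Lemma hausdorff_ptws : hausdorff_space V -> hausdorff_space {ptws U -> V}.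
Proof. by move=> hV; exact: (@hausdorff_product U (fun=> V)). Qed.

Lemma compact_ptws : compact [set: V] -> compact [set: {ptws U -> V}].
Proof.
move=> cV; have := @tychonoff U (fun=> V) (fun=> setT) (fun=> cV).
by congr compact; apply/seteqP; split.
Qed.

End PointwiseTopology.

Section HomSeqTopology.
Variable R : realType.
Local Notation T := (circle R).

Lemma cvg_hom_seq S (F : set_system S) (h : S -> hom_seq R) (f : hom_seq R) : Filter F ->
  (forall k x, (fun s => h s k x) @ F --> f k x) -> h @ F --> f.
Proof.
by move=> FF hf; apply: cvg_ptws => k; apply: cvg_ptws => x; exact: hf.
Qed.

Lemma hom_seq_eval_continuous k (x : T) : continuous (fun phi : hom_seq R => phi k x).
Proof.
move=> phi; apply: (@continuous_comp _ _ _ (fun phi : hom_seq R => phi k)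
  (fun g : {ptws T -> T} => g x)); exact: ptws_eval_continuous.
Qed.

Lemma compact_hom_seq : compact [set: hom_seq R].
Proof. by do 2!apply: compact_ptws; exact: compact_circle. Qed.

Lemma closed_hom_seq_eq (f g : hom_seq R -> T) : continuous f -> continuous g ->
  closed [set phi | f phi = g phi].
Proof.
move=> cf cg; have -> : [set phi | f phi = g phi] = (fun phi => f phi - g phi) @^-1` [set 0].
  by apply/seteqP; split => phi /= => [->|/eqP]; rewrite ?subrr // subr_eq0 => /eqP.
apply: closed_comp; last exact/accessible_closed_set1/hausdorff_accessible/hausdorff_circle.
move=> phi _; apply: (@circle_cvgD R _ (nbhs phi) f (fun p => - g p) (f phi) (- g phi)).
  exact: cf.
by apply: (@circle_cvgN R _ (nbhs phi) g (g phi)); exact: cg.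
Qed.

End HomSeqTopology.

Lemma dvdn_factorial k n : (k <= n)%N -> (k`! %| n`!)%N.
Proof. by move=> kn; rewrite -(bin_fact kn) mulnCA dvdn_mulr. Qed.

(** * The set [calH]: values on the torsion, group structure, compactness *)

Section CalH.
Variable R : realType.
Local Notation T := (circle R).
Implicit Types phi psi : hom_seq R.

Lemma calHE phi : calH phi <-> hom_group phi /\ forall k, (0 < k)%N ->
  forall x, circleQ x -> phi k (x *+ k`!) =
    \sum_(1 <= j < k.+1) iter j (phi 1%N) (x *~ stirling1 k j).
Proof.
have e k x : (\prod_(1 <= j < k.+1) iter j (phi 1%N) (expgz x (stirling1 k j)))%g =
    \sum_(1 <= j < k.+1) iter j (phi 1%N) (x *~ stirling1 k j).
  by apply: eq_bigr => j _; rewrite expgzE.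
by split=> [[h0 hh hs]|[[h0 hh] hs]]; split => // k k0 x Qx; rewrite ?e -?expgE hs.
Qed.

Lemma calH_torsion phi psi k (x : T) n : calH phi -> calH psi ->
  phi 1%N = psi 1%N -> (0 < n)%N -> x *+ n = 0 -> phi k x = psi k x.
Proof.
move=> /calHE[[phi0 _] hphi] /calHE[[psi0 _] hpsi] e1 n0 xn.
case: k => [|k]; first by rewrite phi0 psi0.
have [y yx] := circle_div x (fact_gt0 k.+1).
have Qy : circleQ y.
  apply/circleQP; exists (k.+1`! * n)%N; first by rewrite muln_gt0 fact_gt0.
  by rewrite mulrnA yx.
by rewrite -yx hphi // hpsi // e1.
Qed.

(* Equivalent to the Stirling recurrence of [calH], but visibly stable under
   [star] and inversion. *)
Definition locally_binomial phi := forall m K, (0 < m)%N ->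
  exists a : int, forall k (x : T), (k <= K)%N -> x *+ m = 0 ->
    phi k x = x *~ binz a k.

Lemma iter_hom_mulz (f : T -> T) (x : T) a c j : circle_hom f ->
  f x = x *~ a -> iter j f (x *~ c) = x *~ (c * a ^+ j).
Proof.
move=> hf fx; elim: j => [|j IH]; first by rewrite expr0 mulr1.
rewrite iterS IH (homMz hf) fx -mulrzA; congr (_ *~ _); rewrite exprS; ring.
Qed.

Lemma sum_stirling_binz (x : T) a k :
  \sum_(1 <= j < k.+2) x *~ (stirling1 k.+1 j * a ^+ j) = (x *+ k.+1`!) *~ binz a k.+1.
Proof.
rewrite -(big_morph _ (mulrzDr x) (mulr0z x)) stirling1E.
by rewrite mulrzA pmulrn.
Qed.

Lemma calH_locally_binomial phi : calH phi -> locally_binomial phi.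
Proof.
(* The torsion of order [M] is cyclic, so [phi 1] acts on it as multiplication by some [a]. The
   factor [K]![leaves room to divide points of order]m[by]k[!] without leaving this group. *)
move=> /calHE[[phi0 hphi] hs] m K m0; set M := (m * K`!)%N.
have M0 : (0 < M)%N by rewrite muln_gt0 m0 fact_gt0.
set g := circ ((M%:R : R)^-1); have gM : g *+ M = 0 by exact: circ_invn.
have [|a ga] := @torsion_circ R (phi 1%N g) M M0.
  by rewrite -(homMn (hphi 1%N)) gM (hom0 (hphi 1%N)).
exists a => -[|k] x kK xm; first by rewrite phi0 binz0 mulr1z.
have [t xt] := torsion_circ m0 xm.
have mg : circ ((m%:R : R)^-1) = g *+ K`!.
  have K1 : (K`!)%:R != 0 :> R by rewrite pnatr_eq0 -lt0n fact_gt0.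
  by rewrite /g -circMn -[_ *+ K`!]mulr_natr /M natrM invfM divfK.
have /dvdnP[q Kq] : (k.+1`! %| K`!)%N by exact: dvdn_factorial.
set y := g *~ (t * q%:Z); have yx : y *+ k.+1`! = x.
  by rewrite xt mg Kq /y !pmulrn -!mulrzA PoszM; congr (_ *~ _); ring.
have Qy : circleQ y.
  apply/circleQP; exists M => //.
  by rewrite /y pmulrn -mulrzA mulrC mulrzA -pmulrn gM mul0rz.
rewrite -yx hs //; rewrite -sum_stirling_binz; apply: eq_bigr => j _.
rewrite /y -!mulrzA (iter_hom_mulz _ _ (hphi 1%N) ga).
by congr (_ *~ _); ring.
Qed.

Lemma locally_binomial_calH phi : hom_group phi -> locally_binomial phi -> calH phi.
Proof.
move=> gphi lb; apply/calHE; split => // -[//|k] _ x /circleQP[n n0 xn].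
have [a ha] := lb n k.+1 n0; have [phi0 hphi] := gphi.
have xk : x *+ k.+1`! *+ n = 0 by rewrite mulrnAC xn mul0rn.
rewrite ha // -sum_stirling_binz; apply: eq_bigr => j _.
by rewrite (iter_hom_mulz _ _ (hphi 1%N) (a := a)) // ha // binz1.
Qed.

Lemma calHP phi : calH phi <-> hom_group phi /\ locally_binomial phi.
Proof.
split=> [h|[]]; last exact: locally_binomial_calH.
by split; [case/calHE: h | exact: calH_locally_binomial].
Qed.

Lemma calH_Bin n : calH (@Bin R n).
Proof. by apply/calHP; split; [exact: hom_group_Bin | move=> m K _; exists n]. Qed.

Lemma torsionMz (x : T) m (n : int) : x *+ m = 0 -> (x *~ n) *+ m = 0.
Proof. by move=> xm; rewrite pmulrn -mulrzA mulrC mulrzA -pmulrn xm mul0rz. Qed.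

(** On a given torsion group and up to degree [K] the factors act as [Bin a] and [Bin b], so by
    Vandermonde the product acts as [Bin (a + b)]. *)
Lemma calH_star phi psi : calH phi -> calH psi -> calH (star phi psi).
Proof.
move=> /calHP[gphi lphi] /calHP[gpsi lpsi]; apply/calHP.
split; first exact: hom_group_star.
move=> m K m0; have [a ha] := lphi m K m0; have [b hb] := lpsi m K m0.
exists (a + b) => k x kK xm; rewrite starE -Vandermonde_binz -conv_mulz.
apply: eq_bigr => j _; have jK : (j <= K)%N by rewrite (leq_trans _ kK) // -ltnS.
by rewrite hb // ha ?torsionMz // (leq_trans (leq_subr _ _)).
Qed.

Lemma calH_star_inv phi : calH phi -> calH (star_inv phi).
Proof.
move=> /calHP[gphi lphi]; apply/calHP; split; first exact: hom_group_inv.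
move=> m K m0; have [a ha] := lphi m K m0; exists (- a) => k.
elim/ltn_ind: k => -[|k] IH x kK xm; first by rewrite binz0 mulr1z.
have -> : binz (- a) k.+1 = - \sum_(j < k.+1) binz (- a) (k - j) * binz a j.+1.
  have := Vandermonde_binz (- a) a k.+1; rewrite big_ord_recl binz0 mulr1 subn0.
  by rewrite addNr bin0z // => /eqP; rewrite addr_eq0 => /eqP ->.
rewrite star_invS mulrNz -(conv_mulz (- a) (fun j => binz a j.+1)); congr (- _).
apply: eq_bigr => j _; have jk : (j <= k)%N by rewrite -ltnS.
rewrite ha ?(leq_trans _ kK) // IH ?torsionMz ?ltnS ?leq_subr //.
by rewrite (leq_trans _ kK) // (leq_trans (leq_subr _ _)).
Qed.

Lemma calH_group : is_group (@calH R) (@star R) (@star_one R).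
Proof.
have gH phi : calH phi -> hom_group phi by case/calHP.
split.
- exact: calH_star.
- by move=> u v w /gH[_ hu] _ _; exact: starA.
- by rewrite -Bin0; exact: calH_Bin.
- by move=> u /gH[_ hu]; rewrite star1s stars1.
- move=> u hu; exists (star_inv u); split; first exact: calH_star_inv.
  + exact/star_invK/gH.
  + exact/star_Kinv/gH.
Qed.

Lemma closed_calH : closed (@calH R).
Proof.
have -> : @calH R = [set phi | hom_group phi] `&` [set phi | locally_binomial phi].
  by apply/seteqP; split=> phi /calHP.
apply: closedI.
  have -> : [set phi | hom_group phi] =
      \bigcap_(x : T) [set phi : hom_seq R | phi 0%N x = x] `&`
      \bigcap_(p : nat * (T * T)) [set phi : hom_seq R |
        phi p.1 (p.2.1 + p.2.2) = phi p.1 p.2.1 + phi p.1 p.2.2].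
    apply/seteqP; split => phi.
      by move=> [h0 hh]; split => [x|[k [x y]]] _ /=; rewrite ?h0 //; exact: hh.
    move=> [h0 hh]; split; first by apply/funext => x; exact: h0.
    by move=> k x y; exact: (hh (k, (x, y))).
  apply: closedI; apply: closed_bigI.
    move=> x _; apply: closed_hom_seq_eq; first exact: hom_seq_eval_continuous.
    exact: cst_continuous.
  move=> [k [x y]] _ /=; apply: closed_hom_seq_eq; first exact: hom_seq_eval_continuous.
  move=> phi; apply: (@circle_cvgD R _ (nbhs phi) (fun p : hom_seq R => p k x)
    (fun p : hom_seq R => p k y)); exact: hom_seq_eval_continuous.
pose B m K (a : nat) := \bigcap_(p in [set p : nat * T | (p.1 <= K)%N /\ p.2 *+ m = 0])
  [set phi : hom_seq R | phi p.1 p.2 = p.2 *~ binz a p.1].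
have -> : [set phi | locally_binomial phi] = \bigcap_(p in [set p : nat * nat | (0 < p.1)%N])
    \bigcup_(a in `I_(p.1 * p.2`!)) B p.1 p.2 a.
  apply/seteqP; split => phi.
    move=> lb [m K] /= m0; have [a ha] := lb m K m0.
    have N0 : (0 < m * K`!)%N by rewrite muln_gt0 m0 fact_gt0.
    pose r := `|(a %% (m * K`!)%N)%Z|%N.
    have rE : r%:Z = (a %% (m * K`!)%N)%Z by rewrite /r gez0_abs // modz_ge0 // gt_eqF.
    exists r; first by rewrite /= -ltz_nat rE ltz_pmod.
    move=> [k x] /= [kK xm]; rewrite ha // rE.
    have /dvdnP[q Kq] : (k`! %| K`!)%N by exact: dvdn_factorial.
    have [c] := binz_period k (a %% (m * K`!)%N)%Z ((a %/ (m * K`!)%N)%Z * q) m0.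
    have -> : (a %% (m * K`!)%N)%Z + (a %/ (m * K`!)%N)%Z * q * (m * k`!)%N = a.
      have eM : (m * K`!)%N%:Z = q%:Z * (m * k`!)%N by rewrite Kq -PoszM mulnCA.
      by rewrite -mulrA -eM addrC -divz_eq.
    move=> ->; rewrite mulrzDr [c * _]mulrC mulrzA -pmulrn xm.
    by rewrite mul0rz addr0.
  move=> lb m K m0; have [a _ ha] := lb (m, K) m0.
  by exists a => k x kK xm; exact: (ha (k, x)).
apply: closed_bigI => -[m K] _; apply: closed_bigcup; first exact: finite_II.
move=> a _; apply: closed_bigI => -[k x] _ /=; apply: closed_hom_seq_eq.
  exact: hom_seq_eval_continuous.
exact: cst_continuous.
Qed.

Lemma compact_calH : compact (@calH R).
Proof. by apply: subclosed_compact closed_calH (@compact_hom_seq R) _. Qed.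

End CalH.

(** * Kronecker's theorem *)

Section Kronecker.
Variable R : realType.
Local Notation T := (circle R).
Local Notation C := R[i].

Lemma norm_cval (x : T) : `|cval x| = 1.
Proof. exact/eqP/(valP x). Qed.

Lemma Re_sum I (s : seq I) (P : pred I) (F : I -> C) :
  complex.Re (\sum_(i <- s | P i) F i) = \sum_(i <- s | P i) complex.Re (F i).
Proof. by apply: (big_morph (@complex.Re R)) => // -[a b] [c d]. Qed.

Lemma geometric_bound (z w : T) : z != 0 ->
  exists B : R, forall N, `|\sum_(n < N) re (z *+ n + w)| <= B.
Proof.
move=> z0; set c := cval z.
have c1 : c - 1 != 0.
  by rewrite subr_eq0; apply: contra z0 => /eqP h; apply/eqP/val_inj.
have d0 : 0 < `|c - 1| by rewrite normr_gt0.
exists (complex.Re (2 / `|c - 1|)) => N.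
have -> : \sum_(n < N) re (z *+ n + w) = complex.Re ((c ^+ N - 1) / (c - 1) * cval w).
  rewrite subrX1 [(c - 1) * _]mulrC mulfK // mulr_suml Re_sum.
  by apply: eq_bigr => i _; rewrite /re cvalD cvalMn.
have h : `|(c ^+ N - 1) / (c - 1) * cval w| <= 2 / `|c - 1|.
  rewrite normrM norm_cval mulr1 normrM normfV ler_pM2r ?invr_gt0 //.
  apply: le_trans (ler_normB _ _) _.
  by rewrite normrX norm_cval expr1n normr1.
have := le_trans (normc_ge_Re _) h; rewrite lecE /= => /andP[_]; apply.
Qed.

(** * Counting coincidences between words *)

Section Words.
Variables (d : nat) (x : 'I_d.+1 -> T).
Implicit Type q : nat.

(* [w] is a word of length [q]: such words index the expansion of the [q]-th
   power of a sum of [d.+1] unit complex numbers. *)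
Definition wsum q (y : 'I_d.+1 -> T) (w : {ffun 'I_q -> 'I_d.+1}) : T :=
  \sum_(k < q) y (w k).

Lemma cval_sum I (s : seq I) (P : pred I) (F : I -> T) :
  cval (\sum_(i <- s | P i) F i) = \prod_(i <- s | P i) cval (F i).
Proof. by apply: (big_morph (@cval R)) => // a b; rewrite cvalD. Qed.

Lemma power_sum q (y : 'I_d.+1 -> T) :
  (\sum_i cval (y i)) ^+ q = \sum_w cval (wsum (q := q) y w).
Proof.
have -> : (\sum_i cval (y i)) ^+ q = \prod_(k < q) \sum_i cval (y i).
  by rewrite prodr_const card_ord.
rewrite bigA_distr_bigA /=; apply: eq_bigr => w _.
by rewrite cval_sum.
Qed.

Lemma wsumB q (y z : 'I_d.+1 -> T) (w : {ffun 'I_q -> 'I_d.+1}) :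
  wsum (fun i => y i - z i) w = wsum y w - wsum z w.
Proof. by rewrite /wsum sumrB. Qed.

(** The squared modulus of the sum of the [cval (y i)], multiplied out so as to be a real number;
    see [sqnorm_norm]. *)
Definition sqnorm (y : 'I_d.+1 -> T) : R := \sum_i \sum_j re (y i - y j).

Lemma sqnorm_norm y : (sqnorm y)%:C%C = `|\sum_i cval (y i)| ^+ 2.
Proof.
rewrite -add_Re2_Im2; congr (_ %:C)%C.
have -> : complex.Re (\sum_i cval (y i)) = \sum_i re (y i) by rewrite Re_sum.
have -> : complex.Im (\sum_i cval (y i)) = \sum_i im (y i).
  by apply: (big_morph (@complex.Im R)) => // -[a b] [c d'].
rewrite !expr2 !mulr_suml -big_split; apply: eq_bigr => i _ /=.
rewrite !mulr_sumr -big_split; apply: eq_bigr => j _ /=.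
by rewrite reD reN imN; ring.
Qed.

Lemma sqnormX q y : sqnorm y ^+ q =
  \sum_w \sum_w' re (wsum (q := q) y w - wsum (q := q) y w').
Proof.
apply: (@complexI R); rewrite rmorphXn /= sqnorm_norm -exprM mulnC exprM -normrX power_sum.
rewrite -add_Re2_Im2; congr (_ %:C)%C.
have -> : complex.Re (\sum_w cval (wsum (q := q) y w)) = 
    \sum_w re (wsum (q := q) y w) by rewrite Re_sum.
have -> : complex.Im (\sum_w cval (wsum (q := q) y w)) = \sum_w im (wsum (q := q) y w).
  by apply: (big_morph (@complex.Im R)) => // -[a b] [c d'].
rewrite !expr2 !mulr_suml -big_split; apply: eq_bigr => i _ /=.
rewrite !mulr_sumr -big_split; apply: eq_bigr => j _ /=.
by rewrite reD reN imN; ring.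
Qed.

Lemma sqnorm_ge0 y : 0 <= sqnorm y.
Proof. by rewrite -ler0c sqnorm_norm exprn_ge0. Qed.

(** The letter counts of a word. No count exceeds [q], so [inord] alters nothing. *)
Definition wtype q (w : {ffun 'I_q -> 'I_d.+1}) : {ffun 'I_d.+1 -> 'I_q.+1} :=
  [ffun i => inord #|[pred k | w k == i]|].

Lemma wtype_wsum q (w w' : {ffun 'I_q -> 'I_d.+1}) (y : 'I_d.+1 -> T) :
  wtype w = wtype w' -> wsum y w = wsum y w'.
Proof.
have e (v : {ffun 'I_q -> 'I_d.+1}) : wsum y v = \sum_i y i *+ (wtype v i).
  rewrite /wsum (partition_big v xpredT) //=; apply: eq_bigr => i _.
  rewrite ffunE inordK; last by rewrite ltnS -[X in (_ <= X)%N]card_ord max_card.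
  rewrite (eq_bigr (fun=> y i)) => [|k /eqP -> //].
  transitivity (\sum_(k in [pred k | v k == i]) y i); last by rewrite sumr_const.
  by apply: eq_bigl => k; rewrite inE.
by move=> h; rewrite !e h.
Qed.

Definition coincidences q (y : 'I_d.+1 -> T) : nat :=
  \sum_(w : {ffun 'I_q -> 'I_d.+1}) \sum_(w' : {ffun 'I_q -> 'I_d.+1})
    (wsum y w == wsum y w').

(** Words with equal letter counts have equal sums. The [d.+1 ^ q] words fall into at most
    [q.+1 ^ d.+1] types, and Cauchy-Schwarz bounds the sum of the squared class sizes from below. *)
Lemma coincidences_ge q : (d.+1 ^ (2 * q) <= q.+1 ^ d.+1 * coincidences q x)%N.
Proof.
pose N (t : {ffun 'I_d.+1 -> 'I_q.+1}) : nat := #|[pred w | wtype w == t]|.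
have sN : (\sum_t N t = d.+1 ^ q)%N.
  transitivity (\sum_(w : {ffun 'I_q -> 'I_d.+1}) 1)%N; last first.
    by rewrite sum1_card card_ffun !card_ord.
  rewrite (partition_big (@wtype q) xpredT) //=; apply: eq_bigr => t _.
  by rewrite sum1_card; apply: eq_card => w; rewrite !inE.
have sN2 : (\sum_t N t ^ 2 <= coincidences q x)%N.
  apply: (@leq_trans (\sum_(w : {ffun 'I_q -> 'I_d.+1})
    \sum_(w' : {ffun 'I_q -> 'I_d.+1}) (wtype w == wtype w'))); last first.
    apply: leq_sum => w _; apply: leq_sum => w' _.
    by case: eqP => // /(wtype_wsum x) ->; rewrite eqxx.
  rewrite [leqRHS](partition_big (@wtype q) xpredT) //=; apply: leq_sum => t _.
  rewrite [leqRHS](_ : _ = \sum_(w : {ffun 'I_q -> 'I_d.+1} | wtype w == t) N t)%N.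
    by rewrite sum_nat_const mulnn.
  apply: eq_bigr => w /eqP ->; rewrite /N -sum1_card [RHS]big_mkcond.
  by apply: eq_bigr => w' _; rewrite inE eq_sym; case: eqP.
rewrite mulnC expnM -sN; apply: (@leq_trans (q.+1 ^ d.+1 * \sum_t N t ^ 2)); last first.
  by rewrite leq_mul2l sN2 orbT.
have cT : #|{ffun 'I_d.+1 -> 'I_q.+1}| = (q.+1 ^ d.+1)%N by rewrite card_ffun !card_ord.
rewrite -cT -(leq_pmul2l (isT : (0 < 2)%N)).
have -> : (2 * (#|{ffun 'I_d.+1 -> 'I_q.+1}| * \sum_t N t ^ 2) =
    \sum_(s : {ffun 'I_d.+1 -> 'I_q.+1}) \sum_t (N s ^ 2 + N t ^ 2))%N.
  under [RHS]eq_bigr do rewrite big_split /= sum_nat_const.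
  by rewrite big_split /= -big_distrr /= sum_nat_const addnn -mul2n.
rewrite -mulnn big_distrlr /= big_distrr /=; apply: leq_sum => s _.
rewrite big_distrr /=; apply: leq_sum => t _.
exact: (nat_Cauchy (N s) (N t)).1.
Qed.

End Words.

(* The average over [n] of [sqnorm (fun i => n x i - f (x i)) ^ q] is the number
   of coincidences, whatever the homomorphism [f]: all other terms of the
   expansion are bounded geometric sums. *)
Lemma coincidences_le d (x : 'I_d.+1 -> T) (f : T -> T) q (K : R) :
  circle_hom f ->
  (forall n : nat, sqnorm (fun i => x i *+ n - f (x i)) <= K) ->
  (coincidences q x)%:R <= K ^+ q.
Proof.
move=> hf hK;
pose z (p : {ffun 'I_q -> 'I_d.+1} * {ffun 'I_q -> 'I_d.+1}) := wsum x p.1 - wsum x p.2.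
have fw (w : {ffun 'I_q -> 'I_d.+1}) : wsum (fun i => f (x i)) w = f (wsum x w).
  by rewrite /wsum (hom_sum hf).
have nw n (w : {ffun 'I_q -> 'I_d.+1}) : wsum (fun i => x i *+ n) w = wsum x w *+ n.
  by rewrite /wsum sumrMnl.
have E n : sqnorm (fun i => x i *+ n - f (x i)) ^+ q =
    \sum_(p : {ffun 'I_q -> 'I_d.+1} * {ffun 'I_q -> 'I_d.+1}) re (z p *+ n + - f (z p)).
  rewrite sqnormX pair_bigA /=; apply: eq_bigr => p _; congr re.
  rewrite !wsumB !fw !nw /z (homB hf) mulrnBl !opprB.
  by rewrite addrACA [RHS]addrACA; congr (_ + _); exact: addrC.
have /choice[B hB] : forall p, exists b, z p != 0 -> forall N,
    `|\sum_(n < N) re (z p *+ n + - f (z p))| <= b.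
  move=> p; have [z0|z0] := eqVneq (z p) 0; first by exists 0.
  by have [b hb] := geometric_bound (- f (z p)) z0; exists b.
set S := \sum_(p | z p != 0) B p.
have key N : N%:R * (coincidences q x)%:R - S <= N%:R * K ^+ q.
  apply: (@le_trans _ _ (\sum_(n < N) sqnorm (fun i => x i *+ n - f (x i)) ^+ q)).
    under eq_bigr do rewrite E.
    rewrite exchange_big /= (bigID (fun p => z p == 0)) /=; apply: lerD.
      rewrite /coincidences pair_bigA /= natr_sum mulr_sumr [leRHS]big_mkcond /=.
      apply: ler_sum => p _; rewrite -subr_eq0 -/(z p).
      case: eqP => z0; last by rewrite mulr0.
      rewrite mulr1 -[N in leLHS]card_ord -sum1_card natr_sum.
      by apply: ler_sum => i _; rewrite z0 (hom0 hf) mul0rn subr0 re0.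
    rewrite -sumrN; apply: ler_sum => p /hB /(_ N).
    by rewrite ler_norml => /andP[].
  rewrite -[N in leRHS]card_ord -sum1_card natr_sum mulr_suml; apply: ler_sum => n _.
  by rewrite mul1r lerXn2r ?nnegrE ?sqnorm_ge0 // (le_trans _ (hK 0%N)) ?sqnorm_ge0.
(* If the bound failed, its gap multiplied by a large [N] would exceed the constant [S]; a negative
   [S] already contradicts [key] at [N = 0]. *)
rewrite leNgt; apply/negP => lt; rewrite -subr_gt0 in lt.
have := archi_boundP (x := S / ((coincidences q x)%:R - K ^+ q)).
set N := Num.bound _; case: (leP 0 S) => [S0 /(_ (divr_ge0 S0 (ltW lt)))|S0 _].
  by rewrite ltr_pdivrMr // mulrBr; have := key N; lra.
by have := key 0%N; rewrite !mul0r; lra.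
Qed.

Lemma poly_lt_exp D (r : R) : 0 <= r < 1 -> exists q, (q.+1)%:R ^+ D * r ^+ q < 1.
Proof.
rewrite le0r => /andP[/orP[/eqP ->|r0] r1]; first by exists 1%N; rewrite expr1 mulr0.
set h := - ln r; have h0 : 0 < h by rewrite oppr_gt0 ln_lt0 // r0.
have rE : r = expR (- h) by rewrite opprK lnK.
set M := D.+1; set c := 2 ^+ D * (M`!)%:R / h ^+ M.
have c0 : 0 <= c by rewrite divr_ge0 ?mulr_ge0 ?exprn_ge0 // ltW.
have := archi_boundP c0; set q := Num.bound c => cq.
have q0 : 0 < q%:R :> R by exact: le_lt_trans cq.
exists q; rewrite rE -expRM_natr mulNr expRN -ltr_pdivlMr ?invr_gt0 ?expR_gt0 //.
rewrite mul1r invrK; apply: (@lt_le_trans _ _ (1 + (h * q%:R) ^+ M / (M`!)%:R)); last first.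
  by apply: expR_ge1Dxn => //; rewrite mulr_ge0 // ltW.
apply: (@le_lt_trans _ _ ((2 * q%:R) ^+ D)).
  rewrite lerXn2r ?nnegrE ?mulr_ge0 // -natr1.
  have : 1 <= q%:R :> R by rewrite ler1n -(ltr0n R).
  by lra.
apply: (@lt_trans _ _ ((h * q%:R) ^+ M / (M`!)%:R)); last by rewrite ltrDr.
have f0 : 0 < (M`!)%:R :> R by rewrite ltr0n fact_gt0.
rewrite ltr_pdivlMr // !exprMn exprS [q%:R ^+ M]exprSr.
have hM : 0 < h ^+ M by rewrite exprn_gt0.
rewrite ltr_pdivrMr // in cq.
have -> : 2 ^+ D * q%:R ^+ D * (M`!)%:R = q%:R ^+ D * (2 ^+ D * (M`!)%:R) :> R by ring.
have -> : h * h ^+ D * (q%:R ^+ D * q%:R) = q%:R ^+ D * (q%:R * h ^+ M) :> R.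
  by rewrite /M exprS; ring.
by rewrite ltr_pM2l ?exprn_gt0.
Qed.

Lemma Kronecker (f : T -> T) (xs : seq T) (e : R) : circle_hom f -> 0 < e ->
  exists n : nat, forall x, x \in xs -> 1 - e < re (x *+ n - f x).
Proof.
move=> hf e0; apply: contrapT => hn.
have {}hn n : exists2 x, x \in xs & re (x *+ n - f x) <= 1 - e.
  apply: contrapT => hx; apply: hn; exists n => x xxs; rewrite ltNge.
  by apply/negP => h; apply: hx; exists x.
(* The point 0 joins the list: paired with it, [re (x *+ n - f x)] is itself a term of [sqnorm], so
   a failure at any [x] keeps [sqnorm] at least [e] below its maximum [d.+1 ^ 2]. *)
set d := size xs; pose x (i : 'I_d.+1) := nth 0 (0 :: xs) i.
set K : R := d.+1%:R ^+ 2 - e.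
have hK n : sqnorm (fun i => x i *+ n - f (x i)) <= K.
  have [y yxs hy] := hn n.
  have iP : ((index y xs).+1 < d.+1)%N by rewrite ltnS index_mem.
  pose i0 := Ordinal iP; have xi : x i0 = y by rewrite /x /= nth_index.
  have x0 : x ord0 = 0 by [].
  have -> : K = \sum_(p : 'I_d.+1 * 'I_d.+1) (1 - (if p == (i0, ord0) then e else 0)).
    rewrite sumrB -big_mkcond big_pred1_eq sumr_const card_prod card_ord.
    by rewrite /K -natrX mulnn.
  rewrite /sqnorm pair_bigA; apply: ler_sum => -[i j] _ /=.
  case: eqP => [[-> ->]|_]; last by rewrite subr0 re_le1.
  by rewrite x0 mul0rn (hom0 hf) subrr subr0 xi.
have K0 : 0 <= K by apply: le_trans (hK 0%N); exact: sqnorm_ge0.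
have D0 : 0 < d.+1%:R ^+ 2 :> R by rewrite exprn_gt0 ?ltr0n.
(* The two bounds on [coincidences] give [d.+1 ^ (2 * q) <= q.+1 ^ d.+1 * K ^ q] for every [q],
   impossible for large [q] because [K < d.+1 ^ 2]. *)
have [|q] := @poly_lt_exp d.+1 (K / d.+1%:R ^+ 2).
  by rewrite divr_ge0 ?(ltW D0) //= ltr_pdivrMr // mul1r /K ltrBlDr ltrDl.
rewrite ltNge => /negP; apply.
have := coincidences_ge x q; rewrite -(ler_nat R) natrM !natrX => h1.
have h2 := coincidences_le q hf hK.
rewrite expr_div_n mulrA ler_pdivlMr ?exprn_gt0 // mul1r -exprM.
apply: le_trans h1 _; rewrite ler_wpM2l ?exprn_ge0 //.
Qed.

End Kronecker.

(** * Density of the binomial sequences *)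

Section Hull.
Variable R : realType.
Local Notation T := (circle R).
Implicit Types (xs : seq T) (ts : seq R).

Fixpoint span xs : set T :=
  if xs is x :: s then [set y | exists k : int, span s (y - x *~ k)] else [set 0].

(** The divisible hull of the subgroup generated by [xs], the whole torsion included. *)
Definition hull xs : set T := [set y | exists2 n, (0 < n)%N & span xs (y *+ n)].

Lemma span0 xs : span xs 0.
Proof. by elim: xs => // x s IH; exists 0; rewrite mulr0z subr0. Qed.

Lemma spanB xs a b : span xs a -> span xs b -> span xs (a - b).
Proof.
elim: xs a b => [|x s IH] a b /=; first by move=> -> ->; rewrite subrr.
move=> [k sk] [l sl]; exists (k - l).
have -> : a - b - x *~ (k - l) = (a - x *~ k) - (b - x *~ l); last exact: IH.
by rewrite mulrzBr !opprD addrACA.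
Qed.

Lemma spanMn xs a n : span xs a -> span xs (a *+ n).
Proof.
move=> sa; elim: n => [|n IH]; first exact: span0.
rewrite mulrSr -[a in _ + a]opprK; apply: spanB => //.
by rewrite -sub0r; apply: spanB => //; exact: span0.
Qed.

Lemma hull0 xs : hull xs 0.
Proof. by exists 1%N => //; rewrite mulr1n; exact: span0. Qed.

Lemma hullB xs a b : hull xs a -> hull xs b -> hull xs (a - b).
Proof.
move=> [n n0 na] [m m0 mb]; exists (n * m)%N; first by rewrite muln_gt0 n0.
by rewrite mulrnBl; apply: spanB; [rewrite mulrnA | rewrite mulnC mulrnA]; exact: spanMn.
Qed.

Lemma hullN xs a : hull xs a -> hull xs (- a).
Proof. by rewrite -sub0r; apply: hullB; exact: hull0. Qed.

Lemma hullD xs a b : hull xs a -> hull xs b -> hull xs (a + b).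
Proof. by move=> ha hb; rewrite -[b]opprK; apply: hullB => //; exact: hullN. Qed.

Lemma hullMz xs a (k : int) : hull xs a -> hull xs (a *~ k).
Proof.
move=> ha; have hn n : hull xs (a *+ n).
  by elim: n => [|n IH]; [exact: hull0 | rewrite mulrS; exact: hullD].
by case: k => k; [exact: hn | rewrite NegzE mulrNz; apply: hullN; exact: hn].
Qed.

Lemma hull_rootn xs a n : (0 < n)%N -> hull xs (a *+ n) -> hull xs a.
Proof.
move=> n0 [m m0 h]; exists (n * m)%N; first by rewrite muln_gt0 n0.
by rewrite mulrnA.
Qed.

Lemma hull_rootz xs a (k : int) : k != 0 -> hull xs (a *~ k) -> hull xs a.
Proof.
move=> k0 h; apply: (@hull_rootn _ _ `|k|%N); first by rewrite absz_gt0.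
rewrite pmulrn abszE; case: (ger0P k) => _ //.
by rewrite mulrNz; exact: hullN.
Qed.

Lemma hull_torsion xs a n : (0 < n)%N -> a *+ n = 0 -> hull xs a.
Proof. by move=> n0 an; exists n => //; rewrite an; exact: span0. Qed.

Lemma hull_cons xs x a : hull xs a -> hull (x :: xs) a.
Proof. by move=> [n n0 h]; exists n => //; exists 0; rewrite mulr0z subr0. Qed.

Lemma hull_head xs x : hull (x :: xs) x.
Proof. by exists 1%N => //; exists 1; rewrite subrr; exact: span0. Qed.

Lemma hull_mem xs x : x \in xs -> hull xs x.
Proof.
elim: xs => // y s IH; rewrite inE => /orP[/eqP ->|/IH]; first exact: hull_head.
exact: hull_cons.
Qed.

Lemma hull_split xs x a : hull (x :: xs) a ->
  exists n (k : int), (0 < n)%N /\ hull xs (a *+ n - x *~ k).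
Proof. by move=> [n n0 [k h]]; exists n, k; split => //; exists 1%N. Qed.

(** The rational span of 1 and [ts]: a countable set containing every lift of a point in the hull of
    the [circ t]. *)
Fixpoint rspan ts : set R :=
  if ts is t :: s then [set y | exists q : rat, rspan s (y - ratr q * t)]
  else range (@ratr R).

Lemma countable_rspan ts : countable (rspan ts).
Proof.
elim: ts => [|t s IH] /=; first exact: sub_countable (card_image_le _ _) (countableP _).
have -> : [set y | exists q : rat, rspan s (y - ratr q * t)] =
    \bigcup_(q in [set: rat]) ((fun y => y + ratr q * t) @` rspan s).
  apply/seteqP; split => y.
    by move=> [q h]; exists q => //; exists (y - ratr q * t) => //; rewrite subrK.
  by move=> [q _ [z h <-]]; exists q; rewrite addrK.
by apply: bigcup_countable => // q _; exact: sub_countable (card_image_le _ _) IH.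
Qed.

Lemma rspanZ ts q y : rspan ts y -> rspan ts (ratr q * y).
Proof.
elim: ts y => [|t s IH] y /= [p]; first by move=> _ <-; exists (q * p) => //; rewrite rmorphM.
by move=> /IH; rewrite mulrBr mulrA -rmorphM; exists (q * p).
Qed.

Lemma span_rspan ts t : span (map (@circ R) ts) (circ t) -> rspan ts t.
Proof.
elim: ts t => [|u s IH] t /=.
  by move=> /circ_eq0[n ->]; exists n%:~R => //; rewrite ratr_int.
move=> [k]; rewrite -circMz -circB => /IH h; exists k%:~R.
by rewrite ratr_int mulrzl.
Qed.

Lemma exists_notin_hull xs : exists y, ~ hull xs y.
Proof.
have /choice[s hs] : forall x : T, exists t, circ t = x.
  by move=> x; have [t _] := circ_surj x; exists t.
have -> : xs = map (@circ R) (map s xs).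
  by rewrite -map_comp -[LHS]map_id; apply: eq_map => x /=; rewrite hs.
move: (map s xs) => ts.
have [t ht] : exists t, ~ rspan ts t.
  apply: contrapT => h.
  (* If the rational span were the whole line, the unit interval would be countable and so of
     Lebesgue measure 0. *)
  have cI : countable (`[0, 1]%classic : set R).
    apply: sub_countable (countable_rspan ts); apply: subset_card_le => t _.
    by apply: contrapT => ht; apply: h; exists t.
  have := countable_lebesgue_measure0 cI.
  by rewrite lebesgue_measure_itv /= lte_fin ltr01 oppr0 adde0 => /eqP; rewrite eqe oner_eq0.
exists (circ t) => -[n n0]; rewrite -circMn => /span_rspan /(rspanZ (n%:R^-1)).
by rewrite fmorphV /= ratr_nat -[t *+ n]mulr_natl mulKf // pnatr_eq0 -lt0n.
Qed.

(* [bt] moves [x] to some [y] independent of everything in sight, and [al] reads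
   off the prescribed values from there while vanishing on the original hull. *)
Lemma commutator_hom xs x (dl : T -> T) : circle_hom dl ->
  (forall a, hull xs a -> dl a = 0) ->
  exists al bt : T -> T, [/\ circle_hom al, circle_hom bt,
    forall a n, (0 < n)%N -> a *+ n = 0 -> al a = 0 &
    forall a, hull (x :: xs) a -> al (bt a) - bt (al a) = dl a].
Proof.
move=> hdl dl0; have [xh|xh] := pselect (hull xs x).
  exists (fun=> 0), (fun=> 0); split => //; try by move=> a b; rewrite mulgE addr0.
  move=> a /hull_split[n [k [n0 h]]]; rewrite subrr dl0 //.
  apply: (hull_rootn n0); rewrite -[a *+ n](subrK (x *~ k)).
  by apply: hullD => //; exact: hullMz.
have [y hy] := exists_notin_hull (x :: xs).
(* [bt] kills [hull xs] and sends [x] to [y]. This is consistent because no nonzero multiple of [x]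
   lies in [hull xs]. *)
have [|bt hbt btE] := @divisible_extension _ _ (@circle_div R)
  [set p : T * T | exists a k, hull xs a /\ p = (a + x *~ k, y *~ k)].
  split.
  - by exists 0, 0; split; [exact: hull0 | rewrite !mulr0z addr0].
  - move=> _ _ [a [k [ha ->]]] [b [l [hb ->]]]; exists (a - b), (k - l).
    split; first exact: hullB.
    by rewrite pairB /= !mulrzBr opprD addrACA.
  - move=> d [a [k [ha e]]]; have := congr1 fst e; have := congr1 snd e => /= -> /esym/eqP h.
    have [->|k0] := eqVneq k 0; first exact: mulr0z.
    case: xh; apply: (hull_rootz k0); move: h; rewrite addrC addr_eq0 => /eqP ->.
    exact: hullN.
have bt0 a : hull xs a -> bt a = 0.
  by move=> ha; apply: btE; exists a, 0; rewrite !mulr0z addr0.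
have btx : bt x = y.
  by apply: btE; exists 0, 1; split; [exact: hull0 | rewrite add0r].
(* Some positive multiple of [bt a] is [y *~ k]. As [y] lies outside the larger hull, [k] is 0, and
   then [a] depends on [xs] alone. *)
have btA a : hull (x :: xs) a -> hull (x :: xs) (bt a) -> hull xs a.
  move=> /hull_split[n [k [n0 h]]] hb.
  have := bt0 _ h; rewrite (homB hbt) (homMn hbt) (homMz hbt) btx => /eqP.
  rewrite subr_eq0 => /eqP e; have [k0|k0] := eqVneq k 0.
    by apply: (hull_rootn n0); move: h; rewrite k0 mulr0z subr0.
  by case: hy; apply: (hull_rootz k0); rewrite -e pmulrn; exact: hullMz.
(* [al] kills [hull (x :: xs)] and sends [bt b] to [dl b]. By [btA] the two demands meet only where
   [dl] vanishes. *)
have [|al hal alE] := @divisible_extension _ _ (@circle_div R)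
  [set p : T * T | exists a b, [/\ hull (x :: xs) a, hull (x :: xs) b & p = (a + bt b, dl b)]].
  split.
  - by exists 0, 0; split; rewrite ?(hom0 hbt) ?(hom0 hdl) ?addr0 //; exact: hull0.
  - move=> _ _ [a [b [ha hb ->]]] [a' [b' [ha' hb' ->]]]; exists (a - a'), (b - b').
    split; try exact: hullB.
    by rewrite pairB /= (homB hbt) (homB hdl) opprD addrACA.
  - move=> d [a [b [ha hb e]]]; have := congr1 fst e; have := congr1 snd e => /= -> /esym/eqP h.
    apply: dl0; apply: btA => //.
    by move: h; rewrite addrC addr_eq0 => /eqP ->; exact: hullN.
have al0 a : hull (x :: xs) a -> al a = 0.
  move=> ha; apply: alE; exists a, 0; split => //; first exact: hull0.
  by rewrite (hom0 hbt) (hom0 hdl) addr0.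
exists al, bt; split => //; first by move=> a n n0 an; apply/al0/(hull_torsion _ n0 an).
move=> a ha; rewrite (al0 a ha) (hom0 hbt) subr0; apply: alE; exists 0, a.
by split; rewrite ?add0r //; exact: hull0.
Qed.

End Hull.

(** * The closure of the binomial sequences is [calH] *)

Section Density.
Variable R : realType.
Local Notation T := (circle R).
Implicit Types phi psi nu mu : hom_seq R.

Lemma closure_ptws_circle (A : set {ptws T -> T}) (f : {ptws T -> T}) :
  (forall (xs : seq T) (e : R), 0 < e ->
    exists2 h, A h & forall x, x \in xs -> 1 - e < re (h x - f x)) ->
  closure A f.
Proof.
move=> hA; rewrite closureEcvg /=.
pose B (p : seq T * R) : set {ptws T -> T} :=
  [set h | A h /\ forall x, x \in p.1 -> 1 - p.2 < re (h x - f x)].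
have PF : ProperFilter (filter_from [set p : seq T * R | 0 < p.2] B).
  apply: filter_from_proper; last first.
    by move=> [xs e] /= /(hA xs)[h Ah hh]; exists h.
  apply: filter_from_filter; first by exists ([::], 1) => /=.
  move=> [xs e] [ys e'] /= e0 e0'; exists (xs ++ ys, Num.min e e') => /=.
    by rewrite lt_min e0.
  move=> h [Ah hh]; split; split => // x /= xin.
    have := hh x; rewrite /= mem_cat xin => /(_ isT); apply: le_lt_trans.
    by rewrite lerB // ge_min lexx.
  have := hh x; rewrite /= mem_cat xin orbT => /(_ isT); apply: le_lt_trans.
  by rewrite lerB // ge_min lexx orbT.
exists (filter_from [set p : seq T * R | 0 < p.2] B) => //; split.
  apply/ptws_cvgP => x; apply/circle_cvgP => r r0; exists ([:: x], r) => //=.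
  by move=> h [_ hh]; apply: hh; rewrite inE.
by move=> U AU; exists ([::], 1) => //= h [Ah _]; exact: AU.
Qed.

Lemma closure_image (X Y : topologicalType) (A : set X) (B : set Y) (f : X -> Y) :
  continuous f -> (forall a, A a -> closure B (f a)) ->
  forall p, closure A p -> closure B (f p).
Proof.
move=> cf AB p Ap; apply: closed_closure => U /(cf p) /Ap[a [Aa Ua]].
by exists (f a); split => //; exact: AB.
Qed.

Definition Bin_closure : set (hom_seq R) := closure (range (@Bin R)).
Local Notation BC := Bin_closure.

Lemma compact_Bin_closure : compact BC.
Proof. by apply: subclosed_compact (@closed_closure _ _) (@compact_hom_seq R) _. Qed.

Lemma Bin_closure_Bin n : BC (Bin n).
Proof. by apply: subset_closure; exists n. Qed.

Lemma Bin_closure_calH phi : BC phi -> calH phi.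
Proof.
move=> h; apply: closed_calH; move: phi h; apply: closureS => _ [n _ <-].
exact: calH_Bin.
Qed.

Lemma Bin_closure_hom phi : BC phi -> hom_group phi.
Proof. by move=> /Bin_closure_calH /calHP[]. Qed.

Lemma star_Bin_continuous n : continuous (star (@Bin R n)).
Proof.
move=> psi; apply: (@cvg_hom_seq R _ (nbhs psi)) => k x.
under eq_fun do rewrite starE.
rewrite starE; apply: (@circle_cvg_sum R _ (nbhs psi)) => j _.
apply: (@circle_cvgMz R _ (nbhs psi) (fun p : hom_seq R => p j x)).
exact: hom_seq_eval_continuous.
Qed.

Lemma starr_continuous psi : continuous (fun phi => star phi psi).
Proof.
move=> phi; apply: (@cvg_hom_seq R _ (nbhs phi)) => k x.
under eq_fun do rewrite starE.
rewrite starE; apply: (@circle_cvg_sum R _ (nbhs phi)) => j _; exact: hom_seq_eval_continuous.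
Qed.

(** The usual two steps in a right topological semigroup: [star] is continuous in its left argument,
    and in its right one when the left one is some [Bin m]. *)
Lemma Bin_closure_star phi psi : BC phi -> BC psi -> BC (star phi psi).
Proof.
move=> hphi hpsi; move: phi hphi; apply: closure_image; first exact: starr_continuous.
move=> _ [m _ <-]; move: psi hpsi; apply: closure_image; first exact: star_Bin_continuous.
by move=> _ [n _ <-]; rewrite star_Bin; exact: Bin_closure_Bin.
Qed.

Lemma closed_image_Bin_closure k (A : set (hom_seq R)) : closed A ->
  closed [set (phi k : {ptws T -> T}) | phi in BC `&` A].
Proof.
move=> clA; apply: compact_closed; first exact/hausdorff_ptws/hausdorff_circle.
apply: continuous_compact; last exact: compact_closedI compact_Bin_closure clA.
by apply: continuous_subspaceT; exact: ptws_eval_continuous.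
Qed.

(** Kronecker's theorem only approximates [f] at finitely many points; compactness of the closure
    turns this into equality. *)
Lemma Bin_closure_first (f : T -> T) : circle_hom f -> exists2 mu, BC mu & mu 1%N = f.
Proof.
move=> hf; have := @closed_image_Bin_closure 1 _ closedT; rewrite setIT => clI.
suff [mu hmu mu1] : [set (phi 1%N : {ptws T -> T}) | phi in BC] f by exists mu.
apply: clI; apply: closure_ptws_circle => xs e e0.
have [n hn] := Kronecker xs hf e0.
exists (Bin n 1%N); first by exists (Bin n) => //; exact: Bin_closure_Bin.
by move=> x /hn; rewrite /Bin binz1.
Qed.

Definition vanish_below k phi := forall i x, (0 < i < k)%N -> phi i x = 0.

Definition leading k : set {ptws T -> T} :=
  [set (phi k : {ptws T -> T}) | phi in BC `&` vanish_below k].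

Lemma closed_leading k : closed (leading k).
Proof.
apply: closed_image_Bin_closure.
have -> : vanish_below k = \bigcap_(p in [set p : nat * T | (0 < p.1 < k)%N])
    [set phi : hom_seq R | phi p.1 p.2 = 0].
  apply/seteqP; split => phi h; first by move=> [i x] /= ik; exact: h.
  by move=> i x ik; exact: (h (i, x)).
apply: closed_bigI => -[i x] _ /=; apply: closed_hom_seq_eq.
  exact: hom_seq_eval_continuous.
exact: cst_continuous.
Qed.

Lemma leading_hom k f : leading k f -> circle_hom f.
Proof. by move=> [phi [/Bin_closure_hom[_ h] _] <-]. Qed.

Lemma leading0 k : leading k.+1 (fun=> 0).
Proof.
exists (Bin 0); last by apply/funext => x; rewrite Bin0.
by split; [exact: Bin_closure_Bin | rewrite Bin0; case].
Qed.

Lemma leadingD k f g : leading k.+1 f -> leading k.+1 g -> leading k.+1 (fun x => f x + g x).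
Proof.
move=> [nu [Cnu nuk] <-] [mu [Cmu muk] <-]; exists (star nu mu).
  split; first exact: Bin_closure_star.
  move=> [//|i] x /= ik; rewrite starE conv_first ?nuk ?muk ?addr0 //; first exact: Bin_closure_hom.
  by move=> j y /andP[j0 ji]; apply: nuk; rewrite j0 (ltn_trans ji).
apply/funext => x; rewrite starE conv_first //; last exact: Bin_closure_hom.
by have [-> _] := Bin_closure_hom Cmu.
Qed.

Lemma leadingMn k f n : leading k.+1 f -> leading k.+1 (fun x => f x *+ n).
Proof.
move=> hf; elim: n => [|n IH]; first exact: leading0.
by under eq_fun do rewrite mulrS; exact: leadingD.
Qed.

(* A closed subsemigroup of a compact group is a group: some multiple
   [(n + 1) f] is close to [- f]. *)
Lemma leadingN k f : leading k.+1 f -> leading k.+1 (fun x => - f x).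
Proof.
move=> hf; apply: closed_leading; apply: closure_ptws_circle => xs e e0.
have h2 : circle_hom (fun y : T => y *~ - 2%:Z) by move=> x y; rewrite !mulgE mulrzDl.
have [n hn] := Kronecker (map f xs) h2 e0.
exists (fun x => f x *+ n.+1); first exact: leadingMn.
move=> x xxs; have := hn _ (map_f f xxs); congr (_ < re _).
by rewrite mulrNz !opprK mulrS -[f x *~ 2]/(f x + f x) addrA addrC addrA.
Qed.

Definition approximable k := forall phi, calH phi ->
  exists2 psi, BC psi & forall i, (i <= k)%N -> psi i = phi i.

(** Take [nu] with [al] in degree [k.+1] and nothing before, and [mu] with first term [bt]. The
    products in the two orders agree up to degree [k.+1] and differ by the commutator in the
    next. *)
Lemma leading_commutator k al bt : approximable k.+1 ->
  circle_hom al -> circle_hom bt ->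
  (forall a n, (0 < n)%N -> a *+ n = 0 -> al a = 0) ->
  leading k.+2 (fun x => al (bt x) - bt (al x)).
Proof.
move=> ap hal hbt al0.
pose al_seq : hom_seq R := fun i => if i is 0%N then idfun else if i == k.+1 then al else fun=> 0.
have [|nu Cnu nuE] := ap al_seq.
  apply/calHP; split.
    split=> // -[|i] x y //=; case: ifP => _ //; rewrite !mulgE addr0 //.
  move=> m K m0; exists 0 => -[|i] x _ xm /=; first by rewrite binz0.
  by rewrite bin0z // mulr0z; case: ifP => // _; exact: al0 xm.
have [mu Cmu mu1] := Bin_closure_first hbt.
have gnu := Bin_closure_hom Cnu; have gmu := Bin_closure_hom Cmu.
have nu0 : vanish_below k.+1 nu.
  by move=> [//|i] x /= ik; rewrite nuE ?(ltnW ik) //= ltn_eqF.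
have nu1 : nu k.+1 = al by rewrite nuE //= eqxx.
set rho := star nu mu; set rho' := star mu nu.
have Crho : BC rho by exact: Bin_closure_star.
have Crho' : BC rho' by exact: Bin_closure_star.
(* Multiplying by [psi] removes the terms up to degree [k.+1] of both products. What [psi] does in
   degree [k.+2] is not controlled, but it cancels in the difference. *)
have [psi Cpsi psiE] := ap _ (calH_star_inv (Bin_closure_calH Crho)).
have grho := Bin_closure_hom Crho; have gpsi := Bin_closure_hom Cpsi.
have rE i : (i <= k.+1)%N -> rho i = rho' i.
  move=> ik; apply/funext => x; rewrite /rho /rho' !starE; case: i ik => [|i] ik.
    by rewrite /conv !big_ord1 gmu.1 gnu.1.
  rewrite conv_first //; last first.
    by move=> j y /andP[j0 ji]; apply: nu0; rewrite j0 (leq_trans ji).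
  rewrite conv_recl conv_lowr //=; first by rewrite gmu.1 gnu.1 addrC.
  by move=> j ji; apply: nu0; rewrite /= ltnS (leq_trans ji).
have lead1 : leading k.+2 (star rho psi k.+2).
  exists (star rho psi) => //; split; first exact: Bin_closure_star.
  move=> [//|i] x /= ik; rewrite -[RHS]/(@star_one R i.+1 x) -(star_Kinv grho) !starE.
  by apply: eq_conv => // j ji; rewrite psiE // (leq_trans ji).
have lead2 : leading k.+2 (star rho' psi k.+2).
  exists (star rho' psi) => //; split; first exact: Bin_closure_star.
  move=> [//|i] x /= ik; rewrite -[RHS]/(@star_one R i.+1 x) -(star_Kinv grho) !starE.
  apply: eq_conv => j ji; first by rewrite rE // (leq_trans ji).
  by rewrite psiE // (leq_trans ji).
have := leadingD lead1 (leadingN lead2); congr leading; apply/funext => x.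
rewrite !starE (conv_recl rho) (conv_recl rho') gpsi.1 opprD addrACA.
rewrite [X in _ + X](_ : _ = 0); last first.
  by apply/eqP; rewrite subr_eq0; apply/eqP; apply: eq_conv => // i ik; rewrite rE.
rewrite addr0 /rho /rho' !starE conv_second // conv_second_r //.
  have E (a b c d : T) : a + b + c - (c + (d + a)) = b - d.
    have -> : a + b + c = c + a + b by rewrite addrC addrA.
    have -> : c + (d + a) = c + a + d by rewrite [d + a]addrC addrA.
    by rewrite opprD addrACA subrr add0r.
  by rewrite gmu.1 gnu.1 mu1 nu1 E.
by move=> i ik; exact: nu0.
Qed.

(** By closedness it suffices to match [f] on the hull of each finite list. Points are added one at
    a time: the error [f - g] vanishes on the hull already treated, so a commutator corrects it on
    the next. *)
Lemma leading_torsion_free k f : approximable k.+1 -> circle_hom f ->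
  (forall a n, (0 < n)%N -> a *+ n = 0 -> f a = 0) -> leading k.+2 f.
Proof.
move=> ap hf f0; suff key xs : exists2 g, leading k.+2 g & forall a, hull xs a -> g a = f a.
  apply: closed_leading; apply: closure_ptws_circle => xs e e0.
  have [g Lg gf] := key xs; exists g => // x xxs.
  by rewrite gf ?subrr ?re0 ?ltrBlDr ?ltrDl //; exact: hull_mem.
elim: xs => [|x xs [g Lg gf]].
  exists (fun=> 0); first exact: leading0.
  by move=> a [n n0 an]; rewrite (f0 a n).
have hg := leading_hom Lg.
have [||al [bt [hal hbt al0 E]]] := @commutator_hom _ xs x (fun a => f a - g a).
- by move=> a b; rewrite !mulgE (homD hf) (homD hg) opprD addrACA.
- by move=> a ha; rewrite gf // subrr.
exists (fun a => g a + (al (bt a) - bt (al a))).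
  by apply: leadingD => //; exact: leading_commutator.
by move=> a /E ->; rewrite addrC subrK.
Qed.

Lemma approximableP k : approximable k.
Proof.
elim: k => [|[|k] ap] phi hphi.
- exists (Bin 0); first exact: Bin_closure_Bin.
  move=> [|//] _; have /calHP[[-> _] _] := hphi.
  by rewrite Bin0.
- have /calHP[[phi0 hh] _] := hphi.
  have [mu Cmu mu1] := Bin_closure_first (hh 1%N); exists mu => // -[|[|//]] _ //.
  by rewrite phi0; have [-> _] := Bin_closure_hom Cmu.
- have [psi Cpsi psiE] := ap phi hphi.
  have /calHP[[_ hh] _] := hphi; have [psi0 hpsi] := Bin_closure_hom Cpsi.
  (* With equal first terms, [phi] and [psi] agree on the torsion; their difference in degree [k.+2]
     is therefore a leading term, and multiplying [psi] by its [nu] repairs that degree only. *)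
  have [||nu [Cnu nu0] nuE] := @leading_torsion_free k (fun x => phi k.+2 x - psi k.+2 x) ap.
  + by move=> a b; rewrite !mulgE (homD (hh _)) (homD (hpsi _)) opprD addrACA.
  + move=> a n n0 an; rewrite (calH_torsion _ hphi (Bin_closure_calH Cpsi) _ n0 an) ?subrr //.
    by rewrite psiE.
  exists (star nu psi); first exact: Bin_closure_star.
  have gnu := Bin_closure_hom Cnu.
  move=> [|i] ik; apply/funext => x; rewrite starE.
    by rewrite /conv big_ord1 gnu.1 psiE.
  rewrite conv_first //; last first.
    by move=> j y /andP[j0 ji]; apply: nu0; rewrite j0 (leq_trans ji).
  move: ik; rewrite leq_eqVlt => /orP[/eqP[->]|ik]; last first.
    by rewrite nu0 // add0r psiE.
  by rewrite nuE psi0 subrK.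
Qed.

Lemma Bin_closureE : BC = @calH R.
Proof.
apply/seteqP; split => phi; first exact: Bin_closure_calH.
move=> hphi; have h k : exists psi, BC psi /\ forall i, (i <= k)%N -> psi i = phi i.
  by have [psi] := approximableP k hphi; exists psi.
have [u hu] := choice h.
apply: (@closed_cvg _ _ \oo _ u BC); [exact: closed_closure | |].
  by apply: nearW => k; exact: (hu k).1.
apply: cvg_hom_seq => k x; apply: cvg_near_cst; exists k => // n /= kn.
by rewrite (hu n).2.
Qed.

End Density.

(** * The Ellis group *)

(** From a compact set to a Hausdorff space [e] is a closed map, hence a quotient map, and
    continuity of [f] can be tested after composing with it. *)
Lemma quotient_continuous (X Y Z : topologicalType) (A : set X) (e : X -> Y) (f : Y -> Z) :
  hausdorff_space Y -> compact A -> closed A -> continuous e ->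
  (forall y, exists2 p, A p & e p = y) ->
  (forall p, A p -> (fun q => f (e q)) @ within A (nbhs p) --> f (e p)) ->
  continuous f.
Proof.
move=> hY cA clA ce surj cfe; apply/continuous_closedP => B clB.
have -> : f @^-1` B = e @` (A `&` (fun p => f (e p)) @^-1` B).
  apply/seteqP; split=> [y By|_ [p [_ Bp] <-]] //.
  by have [p Ap ey] := surj y; exists p => //; split; rewrite //= ey.
apply: compact_closed => //; apply: continuous_compact.
  exact: continuous_subspaceT.
apply: subclosed_compact cA _; last by move=> p [].
move=> p Dp; have Ap : A p by apply: clA; apply: closureS Dp => q [].
split => //; apply: contrapT => nB.
have /cfe/(_ (~` B)) := Ap; rewrite nbhs_simpl /= => /(_ _) h.
have /h : nbhs (f (e p)) (~` B) by apply: open_nbhs_nbhs; split => //; exact: closed_openC.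
by rewrite /within /= => /Dp[q [[Aq Bq] /(_ Aq)]].
Qed.

Section EllisGroup.
Variable R : realType.
Local Notation T := (circle R).
Variable x0 : T.
Implicit Types (phi psi : hom_seq R).
Local Notation shift := (shift_mul x0).
Local Notation act := (hom_seq_map x0).
Local Notation E := (enveloping_semigroup shift).

Lemma extend_act phi (x : torus R) : hom_group phi ->
  forall j, extend x0 (act phi x) j = conv phi (extend x0 x) j.
Proof.
move=> [phi0 _] [|j]; last exact: hom_seq_mapE.
by rewrite /conv big_ord1 phi0.
Qed.

Lemma act_star phi psi : hom_group phi -> hom_group psi ->
  act (star phi psi) = ptws_comp (act phi) (act psi).
Proof.
move=> gphi gpsi; apply/funext => x; apply/funext => i.
rewrite /ptws_comp /= !hom_seq_mapE -conv_comp; last exact: gphi.2.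
by apply: eq_conv => // j _; rewrite extend_act.
Qed.

Lemma act_one : act (@star_one R) = idfun.
Proof.
apply/funext => x; apply/funext => i; rewrite hom_seq_mapE conv_first ?add0r //.
  exact: hom_group_one.
by case.
Qed.

Lemma shift_act : shift = act (Bin 1).
Proof.
apply/funext => x; apply/funext => i; rewrite hom_seq_mapE conv_recr /shift_mul mulgE.
rewrite (_ : Bin 1 0%N _ = extend x0 x i.+1); last by rewrite /Bin binz0.
suff -> : conv (Bin 1 \o succn) (extend x0 x) i = extend x0 x i by [].
case: i => [|i]; first by rewrite /conv big_ord1 /= /Bin binz1.
by rewrite conv_recr /= {2}/Bin binz1 mulr1z /conv big1 ?add0r.
Qed.

Lemma act_BinD m n : act (Bin (m + n)) = ptws_comp (act (Bin m)) (act (Bin n)).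
Proof. by rewrite -star_Bin act_star //; exact: hom_group_Bin. Qed.

Lemma act_BinN n : cancel (act (Bin n)) (act (Bin (- n))).
Proof.
move=> x; rewrite -[LHS]/(ptws_comp (act (Bin (- n))) (act (Bin n)) x) -act_BinD.
by rewrite addNr Bin0 act_one.
Qed.

Lemma act_BinNK n : cancel (act (Bin (- n))) (act (Bin n)).
Proof. by move=> x; rewrite -[n in act (Bin n)]opprK act_BinN. Qed.

Lemma shift_bijective : bijective shift.
Proof. by rewrite shift_act; exists (act (Bin (- 1))); [exact: act_BinN|exact: act_BinNK]. Qed.

Lemma pinv_shift : pinv setT shift = act (Bin (- 1)).
Proof.
apply/funext => y; apply: (bij_inj shift_bijective).
rewrite pinvK; last first.
  by rewrite inE; exists (act (Bin (- 1)) y) => //; rewrite shift_act act_BinNK.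
by rewrite shift_act act_BinNK.
Qed.

Lemma ziter_shift n : ziter shift n = act (Bin n).
Proof.
have it m k : iter k (act (Bin m)) = act (Bin (m * k%:Z)).
  elim: k => [|k IH]; first by rewrite mulr0 Bin0 act_one.
  apply/funext => x; rewrite iterS IH.
  rewrite -[LHS]/(ptws_comp (act (Bin m)) (act (Bin (m * k%:Z))) x) -act_BinD.
  by congr (act (Bin _) x); rewrite -[k.+1]add1n PoszD mulrDr mulr1.
case: n => n; first by rewrite /ziter shift_act it mul1r.
by rewrite /ziter pinv_shift it NegzE mulN1r.
Qed.

Lemma act_continuous : continuous (fun phi => act phi).
Proof.
move=> phi; apply: (@cvg_ptws _ _ _ (nbhs phi)) => x.
apply: (@cvg_ptws _ _ _ (nbhs phi)) => i.
under eq_fun do rewrite hom_seq_mapE.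
rewrite hom_seq_mapE; apply: (@circle_cvg_sum R _ (nbhs phi)) => j _.
exact: hom_seq_eval_continuous.
Qed.

Lemma act_Bin_continuous n : continuous (act (Bin n)).
Proof.
move=> x; apply: (@cvg_ptws _ _ _ (nbhs x)) => i.
under eq_fun do rewrite hom_seq_mapE.
rewrite hom_seq_mapE; apply: (@circle_cvg_sum R _ (nbhs x)) => j _.
apply: (@circle_cvgMz R _ (nbhs x) (fun y : torus R => extend x0 y j)).
case: (nat_of_ord j) => [|k]; first exact: cvg_cst.
exact: (@ptws_eval_continuous _ _ k x).
Qed.

Lemma compact_torus : compact [set: torus R].
Proof. exact/compact_ptws/compact_circle. Qed.

Lemma hausdorff_torus : hausdorff_space (torus R).
Proof. exact/hausdorff_ptws/hausdorff_circle. Qed.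

Lemma shift_dynamical_system : dynamical_system shift.
Proof.
split; [exact: compact_torus | exact: hausdorff_torus | split].
- exact: shift_bijective.
- by rewrite shift_act; exact: act_Bin_continuous.
- by rewrite pinv_shift; exact: act_Bin_continuous.
Qed.

(** [act] carries the [Bin n] to the iterates, and the image of the compact closure of the [Bin n]
    is closed, so closure and image commute. *)
Lemma enveloping_semigroupE : E = [set act phi | phi in @calH R].
Proof.
have rE : range (ziter shift) = [set act phi | phi in range (@Bin R)].
  apply/seteqP; split=> [_ [n _ <-]|_ [_ [n _ <-] <-]].
    by exists (Bin n); [exists n | rewrite ziter_shift].
  by exists n => //; rewrite ziter_shift.
rewrite /enveloping_semigroup rE -Bin_closureE; apply/seteqP; split.
  have clI : closed [set act phi | phi in @Bin_closure R].
    apply: compact_closed; first exact/hausdorff_ptws/hausdorff_torus.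
    apply: continuous_compact; last exact: compact_Bin_closure.
    exact/continuous_subspaceT/act_continuous.
  move=> u hu; apply: clI; move: u hu; apply: closureS => _ [phi hphi <-].
  by exists phi => //; exact: subset_closure.
move=> _ [phi hphi <-]; move: phi hphi; apply: closure_image; first exact: act_continuous.
by move=> phi hphi; apply: subset_closure; exists phi.
Qed.

Definition first_coordinate (y : T) : torus R := fun i => if i is 0%N then y else 0.

(* A map of the form [act phi] determines [phi]: feed it the sequences
   [(y, 0, 0, ...)] and divide out the contribution of [x0]. *)
Definition coefficients (u : {ptws torus R -> torus R}) : hom_seq R :=
  fun k y => u (first_coordinate y) k - u (fun=> 0) k.

Lemma act_coefficients phi : hom_group phi -> coefficients (act phi) = phi.
Proof.
move=> [_ hphi]; apply: hom_seq_ext => k y; rewrite /coefficients !hom_seq_mapE !conv_recl /=.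
rewrite opprD addrACA subrr add0r.
have z (z : nat -> T) l : (forall i, z i = 0) -> conv phi z l = 0.
  by move=> z0; rewrite /conv big1 // => i _; rewrite z0 (hom0 (hphi _)).
rewrite [X in _ - X]z // subr0; case: k => [|k]; first by rewrite /conv big_ord1.
by rewrite conv_recl z ?addr0.
Qed.

Lemma coefficients_continuous : continuous coefficients.
Proof.
move=> u; apply: (@cvg_hom_seq R _ (nbhs u)) => k y.
have ev (x : torus R) : (fun v : {ptws torus R -> torus R} => v x k) @ nbhs u --> u x k.
  apply: (@continuous_comp _ _ _ (fun v : {ptws torus R -> torus R} => v x)
    (fun z : torus R => z k)); exact: ptws_eval_continuous.
apply: (@circle_cvgD R _ (nbhs u) _ (fun v => - v (fun=> 0) k)); first exact: ev.
by apply: (@circle_cvgN R _ (nbhs u) (fun v => v (fun=> 0) k)); exact: ev.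
Qed.

Lemma calH_hom_group phi : calH phi -> hom_group phi.
Proof. by case/calHP. Qed.

Lemma shift_distal : distal shift.
Proof.
rewrite /distal enveloping_semigroupE.
have [sH _ oneH _ invH] := calH_group R.
split.
- move=> _ _ [phi hphi <-] [psi hpsi <-]; exists (star phi psi); first exact: sH.
  by rewrite act_star //; exact: calH_hom_group.
- by [].
- by exists (@star_one R) => //; exact: act_one.
- by [].
- move=> _ [phi hphi <-]; have [psi [hpsi e1 e2]] := invH _ hphi.
  have gphi := calH_hom_group hphi; have gpsi := calH_hom_group hpsi.
  exists (act psi); split; first by exists psi.
  + by rewrite -act_star // e1 act_one.
  + by rewrite -act_star // e2 act_one.
Qed.

Lemma enveloping_semigroup_isomorphic :
  topologically_isomorphic E (@ptws_comp (torus R)) (@calH R) (@star R).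
Proof.
rewrite enveloping_semigroupE; exists coefficients, (fun phi => act phi); split.
- split; last by move=> phi hphi; exists phi.
  by move=> _ [phi hphi <-]; rewrite act_coefficients //; exact: calH_hom_group.
- split; last by move=> phi /calH_hom_group /act_coefficients.
  by move=> _ [phi /calH_hom_group hphi <-]; rewrite act_coefficients.
- move=> _ _ [phi /calH_hom_group gphi <-] [psi /calH_hom_group gpsi <-].
  by rewrite -act_star // !act_coefficients //; exact: hom_group_star.
- exact/continuous_subspaceT/coefficients_continuous.
- exact/continuous_subspaceT/act_continuous.
Qed.

Lemma exists_nontorsion : exists x : T, forall k : int, x *~ k = 0 -> k = 0.
Proof.
have [x hx] := exists_notin_hull ([::] : seq T); exists x => k xk.
apply: contrapT => /eqP k0; apply: hx; apply: (hull_rootz k0).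
by rewrite xk; exact: hull0.
Qed.

(** As [x] has infinite order, sending it to [y] defines a homomorphism on its multiples, which
    extends to the circle. *)
Lemma calH_first_surj (x y : T) : (forall k : int, x *~ k = 0 -> k = 0) ->
  exists2 psi, calH psi & psi 1%N x = y.
Proof.
move=> hx; have [|h hh hE] := @divisible_extension _ _ (@circle_div R)
  [set p : T * T | exists k, p = (x *~ k, y *~ k)].
  split.
  - by exists 0; rewrite !mulr0z.
  - by move=> _ _ [k ->] [l ->]; exists (k - l); rewrite pairB /= !mulrzBr.
  - move=> d [k e]; have := congr1 fst e; have := congr1 snd e => /= -> /esym /hx ->.
    exact: mulr0z.
have [mu Cmu mu1] := Bin_closure_first hh.
by exists mu; [exact: Bin_closure_calH | rewrite mu1; apply: hE; exists 1].
Qed.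

(** * The topological centre *)

Section Centre.
Variable phi : hom_seq R.
Hypothesis phiH : calH phi.
Hypothesis phi_cts : {within E, continuous (@ptws_comp (torus R) (act phi))}.

Lemma star_within_cvg psi k (x : T) : calH psi ->
  (fun chi => star phi chi k x) @ within (@calH R) (nbhs psi) --> star phi psi k x.
Proof.
move=> hpsi; have gphi := calH_hom_group phiH.
have Epsi : E (act psi) by rewrite enveloping_semigroupE; exists psi.
have c1 : (fun chi => ptws_comp (act phi) (act chi)) @ within (@calH R) (nbhs psi)
    --> ptws_comp (act phi) (act psi).
  move/subspace_continuousP : phi_cts => /(_ _ Epsi) c U /c.
  rewrite !nbhs_simpl /within /= => h.
  have := act_continuous h; rewrite nbhs_simpl /=; apply: filterS => chi hU hchi.
  by apply: hU; rewrite enveloping_semigroupE; exists chi.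
have c2 := cvg_comp _ _ c1 (@coefficients_continuous _).
have c3 := cvg_comp _ _ c2 (@hom_seq_eval_continuous R k x _).
have -> : star phi psi k x = coefficients (ptws_comp (act phi) (act psi)) k x.
  have gpsi := calH_hom_group hpsi.
  by rewrite -act_star // act_coefficients //; exact: hom_group_star.
apply: cvg_trans c3; apply: near_eq_cvg; rewrite near_withinE; apply: nearW => chi hchi /=.
have gchi := calH_hom_group hchi.
by rewrite -act_star // act_coefficients //; exact: hom_group_star.
Qed.

Lemma centre_term_continuous k : continuous (phi k).
Proof.
have [phi0 hphi] := calH_hom_group phiH.
elim/ltn_ind: k => -[|k] IH; first by rewrite phi0 => x; exact: cvg_id.
have [x hx] := exists_nontorsion.
apply: (@quotient_continuous _ _ _ (@calH R) (fun psi => psi 1%N x)).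
- exact: hausdorff_circle.
- exact: compact_calH.
- exact: closed_calH.
- exact: hom_seq_eval_continuous.
- by move=> y; exact: calH_first_surj.
move=> psi hpsi; pose tail (chi : hom_seq R) := conv phi (fun j => chi j.+2 x) k.
(* Degree [k.+2] of [star phi chi] at [x] is solved for [phi k.+1 (chi 1 x)]; what remains in [tail]
   involves only terms of [phi] up to degree [k], continuous by induction. *)
have e chi : calH chi -> phi k.+1 (chi 1%N x) = star phi chi k.+2 x - phi k.+2 x - tail chi.
  move=> /calH_hom_group[chi0 _]; rewrite starE (conv_recl phi) chi0 (conv_recl phi) /=.
  by rewrite [phi k.+2 x + _]addrC addrK; exact/esym/addrK.
have ct : tail @ within (@calH R) (nbhs psi) --> tail psi.
  apply: cvg_within_filter; apply: (@circle_cvg_sum R _ (nbhs psi)) => j _.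
  apply: (@continuous_comp _ _ _ (fun chi : hom_seq R => chi j.+2 x) (phi (k - j)%N)).
    exact: hom_seq_eval_continuous.
  by apply: IH; rewrite ltnS leq_subr.
have PF : Filter (within (@calH R) (nbhs psi)) by exact: within_filter.
rewrite e //; apply: (@cvg_trans _ ((fun chi => star phi chi k.+2 x - phi k.+2 x - tail chi)
    @ within (@calH R) (nbhs psi))).
  by apply: near_eq_cvg; rewrite near_withinE; apply: nearW => chi /e.
apply: circle_cvgD; last exact: circle_cvgN.
by apply: circle_cvgD; [exact: star_within_cvg | exact: cvg_cst].
Qed.

Lemma centre_Bin : exists n, phi = Bin n.
Proof.
have [_ hphi] := calH_hom_group phiH.
have [n hn] := continuous_circle_hom (hphi 1%N) (@centre_term_continuous 1%N).
exists n; apply/funext => k; apply: (@dyadic_dense R _ _ 0).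
- exact: centre_term_continuous.
- move=> x; apply: (@circle_cvgMz R _ (nbhs x) id x); exact: cvg_id.
move=> j c _; apply: (calH_torsion _ phiH (calH_Bin _ _) _ _ (dyadic_torsion R j c)).
  by apply/funext => x; rewrite hn /Bin binz1.
by rewrite expn_gt0.
Qed.

End Centre.

Lemma topological_centre_shift :
  topological_centre E (@ptws_comp (torus R)) = range (ziter shift).
Proof.
apply/seteqP; split.
  move=> v [Ev cv]; have := Ev; rewrite {1}enveloping_semigroupE => -[phi hphi ev].
  rewrite -ev in cv; have [n en] := centre_Bin hphi cv.
  by exists n => //; rewrite ziter_shift -ev en.
move=> _ [n _ <-]; split.
  by rewrite enveloping_semigroupE; exists (Bin n); [exact: calH_Bin | rewrite ziter_shift].
apply: continuous_subspaceT => u; apply: (@cvg_ptws _ _ _ (nbhs u)) => x.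
apply: (@continuous_comp _ _ _ (fun v : {ptws torus R -> torus R} => v x) (ziter shift n)).
  exact: ptws_eval_continuous.
by rewrite ziter_shift; exact: act_Bin_continuous.
Qed.

End EllisGroup.

Theorem theorem3p8 (R : realType) (x0 : circle R) :
  [/\ dynamical_system (shift_mul x0) /\ distal (shift_mul x0),
      (exists e, is_group (@calH R) (@star R) e) /\
      topologically_isomorphic
        (enveloping_semigroup (shift_mul x0)) (@ptws_comp (torus R))
        (@calH R) (@star R),
      topological_centre
        (enveloping_semigroup (shift_mul x0)) (@ptws_comp (torus R))
        = range (ziter (shift_mul x0)) &
      enveloping_semigroup (shift_mul x0)
        = [set hom_seq_map x0 phi | phi in @calH R]].
Proof.
split.
- by split; [exact: shift_dynamical_system | exact: shift_distal].
- split; first by exists (@star_one R); exact: calH_group.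
  exact: enveloping_semigroup_isomorphic.
- exact: topological_centre_shift.
- exact: enveloping_semigroupE.
Qed.
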